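(* Let $X$ and $Y$ be Banach spaces over $\mathbb K\in\{\mathbb R,\mathbb C\}$, both of dimension at least two. Then $$C_{\mathrm{NJ}}(X\widehat\otimes_{\varepsilon}Y)\ge\max\left\{C_{\mathrm{NJ}}(X),\,C_{\mathrm{NJ}}(Y),\,\frac{2}{\eta_2(X)^2\eta_2(Y)^2}\right\},$$ $$C_{\mathrm{NJ}}(X\widehat\otimes_{\pi}Y)\ge\max\left\{C_{\mathrm{NJ}}(X),\,C_{\mathrm{NJ}}(Y),\,\frac{2}{\eta_2(X^* )^2\eta_2(Y^* )^2}\right\}.$$
   Context: For a Banach space $X$, the von Neumann--Jordan constant is $$C_{\mathrm{NJ}}(X)=\sup\left\{\frac{\|x+y\|^{2}+\|x-y\|^{2}}{2(\|x\|^{2}+\|y\|^{2})}: x,y\in X,\ (x,y)\neq(0,0)\right\}.$$ For Banach spaces $X,Y$ over $\mathbb K$, and $w=\sum_{j=1}^r x_j\otimes y_j$ in the algebraic tensor product $X\otimes Y$, the injective norm is $\|w\|_\varepsilon=\sup\{|\sum_{j} x^*(x_j)y^*(y_j)|: x^*\in B_{X^*},\,y^*\in B_{Y^*}\}$ and the projective norm is $\|w\|_\pi=\inf\{\sum_{j}\|x_j\|\|y_j\|: w=\sum_{j} x_j\otimes y_j\}$. The completions of $X\otimes Y$ for these norms are denoted $X\widehat\otimes_\varepsilon Y$ and $X\widehat\otimes_\pi Y$. $d(E,F)=\inf\{\|T\|\|T^{-1}\|: T:E\to F \text{ a linear isomorphism}\}$ is the Banach--Mazur distance, $\ell_2^d$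 is $\mathbb K^d$ with the Euclidean norm, and $$\eta_2(X)=\inf\{d(E,\ell_2^2): E\subset X \text{ a linear subspace},\ \dim E=2\}.$$ *)

(* Defs.v *)
From HB Require Import structures.
From mathcomp Require Import all_boot all_order all_algebra.
From mathcomp Require Import complex ring.
From mathcomp Require Import mathcomp_extra boolp classical_sets functions.
From mathcomp Require Import reals ereal topology normedtype.

Set Implicit Arguments.
Unset Strict Implicit.
Unset Printing Implicit Defensive.

Import Order.TTheory GRing.Theory Num.Theory.
Import numFieldNormedType.Exports.

Local Open Scope classical_set_scope.
Local Open Scope ring_scope.
Local Open Scope complex_scope.
Local Open Scope quotient_scope.

(* The scalar field is R or R[i]. Norms in MathComp-Analysis take their values
   in the scalar field; [re] and [of_real] move between it and R. *)
Inductive scalar_kind := RealScalars | ComplexScalars.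

Definition scalar_field (R : realType) (k : scalar_kind) : numFieldType :=
  match k with RealScalars => R | ComplexScalars => R[i] end.

Definition re (R : realType) (k : scalar_kind) : scalar_field R k -> R :=
  match k with
  | RealScalars => fun x : R => x
  | ComplexScalars => fun z : R[i] => complex.Re z
  end.

Definition of_real (R : realType) (k : scalar_kind) : R -> scalar_field R k :=
  match k with
  | RealScalars => fun x : R => x
  | ComplexScalars => fun x : R => x%:C
  end.

Definition rnorm (R : realType) (k : scalar_kind)
  (V : normedModType (scalar_field R k)) (x : V) : R := re `|x|.

Section ScalarTheory.
Context {R : realType} {k : scalar_kind}.
Notation K := (scalar_field R k).

Lemma re_of_real (a : R) : re (of_real k a) = a.
Proof. by case: k. Qed.

Lemma of_real0 : of_real k (0 : R) = 0.
Proof. by case: k. Qed.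

Lemma of_real1 : of_real k (1 : R) = 1.
Proof. by case: k. Qed.

Lemma of_realD (a b : R) : of_real k (a + b) = of_real k a + of_real k b.
Proof. by case: k => //=; rewrite rmorphD. Qed.

Lemma of_realM (a b : R) : of_real k (a * b) = of_real k a * of_real k b.
Proof. by case: k => //=; rewrite rmorphM. Qed.

Lemma ler_of_real (a b : R) : (of_real k a <= of_real k b) = (a <= b).
Proof. by case: k => //=; rewrite lecR. Qed.

Lemma of_real_re (z : K) : 0 <= z -> of_real k (re z) = z.
Proof.
by move: z; case: k => //= -[a b]; rewrite lecE /= => /andP[/eqP ->].
Qed.

Lemma rnorm_ge0 (V : normedModType K) (x : V) : 0 <= rnorm x.
Proof.
by rewrite -ler_of_real /rnorm of_real_re // of_real0.
Qed.

Lemma of_real_rnorm (V : normedModType K) (x : V) :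
  of_real k (rnorm x) = `|x|.
Proof. exact: of_real_re. Qed.

Lemma rnormD (V : normedModType K) (x y : V) :
  rnorm (x + y) <= rnorm x + rnorm y.
Proof. by rewrite -ler_of_real of_realD !of_real_rnorm ler_normD. Qed.

Lemma rnormZ (V : normedModType K) (a : K) (x : V) :
  rnorm (a *: x) = rnorm (a : K^o) * rnorm x.
Proof.
by rewrite -[LHS](re_of_real) of_real_rnorm normrZ -!of_real_rnorm -of_realM
  re_of_real.
Qed.

Lemma rnorm0 (V : normedModType K) : rnorm (0 : V) = 0.
Proof. by rewrite -[LHS](re_of_real) of_real_rnorm normr0 -of_real0 re_of_real. Qed.

Lemma rnorm_eq0 (V : normedModType K) (x : V) : rnorm x = 0 -> x = 0.
Proof. by move=> x0; apply/normr0_eq0; rewrite -of_real_rnorm x0 of_real0. Qed.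

Lemma rnorm_of_real (a : R) : 0 <= a -> rnorm (of_real k a : K^o) = a.
Proof.
move=> a0; rewrite /rnorm ger0_norm ?re_of_real//.
by rewrite -of_real0 ler_of_real.
Qed.

End ScalarTheory.

Definition free_family (K : numFieldType) (V : lmodType K) (n : nat)
    (b : 'I_n -> V) : Prop :=
  forall c : 'I_n -> K, \sum_(i < n) c i *: b i = 0 -> forall i, c i = 0.

Definition spanning_family (K : numFieldType) (V : lmodType K) (n : nat)
    (b : 'I_n -> V) : Prop :=
  forall v : V, exists c : 'I_n -> K, v = \sum_(i < n) c i *: b i.

Definition dim_ge (K : numFieldType) (V : lmodType K) (n : nat) : Prop :=
  exists b : 'I_n -> V, free_family b.

Definition dim_eq (K : numFieldType) (V : lmodType K) (n : nat) : Prop :=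
  exists b : 'I_n -> V, free_family b /\ spanning_family b.

Definition opnorm (R : realType) (k : scalar_kind)
    (V W : normedModType (scalar_field R k)) (f : V -> W) : \bar R :=
  ereal_sup [set (rnorm (f x))%:E | x in [set x : V | rnorm x <= 1]].

Section OpnormTheory.
Context {R : realType} {k : scalar_kind} {V W : normedModType (scalar_field R k)}.
Notation K := (scalar_field R k).
Implicit Types f g : V -> W.

Lemma opnorm_ub f x : rnorm x <= 1 -> ((rnorm (f x))%:E <= opnorm f)%E.
Proof. by move=> x1; apply: ereal_sup_ubound; exists x. Qed.

Lemma opnorm_ge0 f : (0 <= opnorm f)%E.
Proof.
by apply: le_trans (opnorm_ub f (x := 0) _); rewrite ?lee_fin ?rnorm_ge0 ?rnorm0.
Qed.

Lemma opnormD f g : (opnorm (f + g)%R <= opnorm f + opnorm g)%E.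
Proof.
apply: ub_ereal_sup => _ [x /= x1 <-].
apply: (@le_trans _ _ ((rnorm (f x))%:E + (rnorm (g x))%:E)%E).
  by rewrite -EFinD lee_fin rnormD.
by apply: leeD; exact: opnorm_ub.
Qed.

Lemma opnormZ_le (a : K) f :
  (opnorm (a *: f)%R <= (rnorm (a : K^o))%:E * opnorm f)%E.
Proof.
apply: ub_ereal_sup => _ [x /= x1 <-].
rewrite rnormZ EFinM; apply: lee_pmul; rewrite ?lee_fin ?rnorm_ge0//.
exact: opnorm_ub.
Qed.

Lemma opnorm_eq0 f : linear f -> opnorm f = 0%E -> f = 0.
Proof.
move=> lf f0; apply/funext => x; apply: rnorm_eq0.
pose F : {linear V -> W} := HB.pack f (GRing.isLinear.Build _ _ _ _ f lf).
have fZ0 : f 0 = 0 by exact: (linear0 F).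
have fZ a y : f (a *: y) = a *: f y by exact: (linearZZ F).
have [->|x0] := eqVneq x 0; first by rewrite fZ0 rnorm0.
have rx0 : 0 < rnorm x.
  rewrite lt_neqAle rnorm_ge0 andbT eq_sym.
  by apply: contraNneq x0 => /rnorm_eq0 ->.
have := @opnorm_ub f (of_real k (rnorm x)^-1 *: x).
rewrite fZ f0 !rnormZ.
rewrite rnorm_of_real ?invr_ge0 ?rnorm_ge0// mulVf ?gt_eqF//.
rewrite lee_fin pmulr_rle0 ?invr_gt0// => /(_ (lexx _)) fx0.
by apply/eqP; rewrite eq_le rnorm_ge0 fx0.
Qed.

Lemma opnorm_fin f : linear f -> continuous f -> opnorm f \is a fin_num.
Proof.
move=> lf cf; rewrite ge0_fin_numE ?opnorm_ge0//.
pose F : {linear V -> W} := HB.pack f (GRing.isLinear.Build _ _ _ _ f lf).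
have /linear_boundedP/pinfty_ex_gt0[M M0 fM] :
  bounded_near F (nbhs (0 : V)) by apply/linear_bounded_continuous.
apply: (@le_lt_trans _ _ (re M)%:E); last exact: ltry.
apply: ub_ereal_sup => _ [x /= x1 <-].
rewrite lee_fin -(@ler_of_real _ k) of_real_rnorm of_real_re; last exact: ltW.
apply: le_trans (fM x) _.
have : of_real k (rnorm x) <= of_real k 1 by rewrite ler_of_real.
by rewrite of_real1 of_real_rnorm => x1'; rewrite ler_piMr// ltW.
Qed.

End OpnormTheory.

Section Dual.
Context {R : realType} {k : scalar_kind} (X : normedModType (scalar_field R k)).
Notation K := (scalar_field R k).

Definition dual_pred : {pred X -> K^o} :=
  fun f => `[< linear f /\ continuous f >].

Lemma dual_submod_closed : submod_closed dual_pred.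
Proof.
split.
  apply/asboolP; split; last exact: cst_continuous.
  by move=> a u v /=; rewrite scaler0 addr0.
move=> a f g /asboolP[lf cf] /asboolP[lg cg]; apply/asboolP; split.
  move=> b u v /=; rewrite !fctE lf lg.
  by rewrite !scalerDr !scalerA [a * b]mulrC addrACA.
move=> x; apply: (@continuousD _ _ _ (a *: f) g); last exact: cg.
by apply: continuousZ; [exact: cst_continuous|exact: cf].
Qed.

HB.instance Definition _ :=
  GRing.isSubmodClosed.Build K (X -> K^o) dual_pred dual_submod_closed.

Definition dual : Type := {f : X -> K^o | f \in dual_pred}.

HB.instance Definition _ := [isSub of dual for @sval _ _].
HB.instance Definition _ := [Choice of dual by <:].
HB.instance Definition _ := [SubChoice_isSubLmodule of dual by <:].

Definition dual_fun (f : dual) : X -> K^o := \val f.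

Lemma dual_funP (f : dual) : linear (dual_fun f) /\ continuous (dual_fun f).
Proof. exact/asboolP/(valP f). Qed.

Definition dual_norm (f : dual) : K := of_real k (fine (opnorm (dual_fun f))).

Lemma dual_opnormE (f : dual) :
  (fine (opnorm (dual_fun f)))%:E = opnorm (dual_fun f).
Proof. by case: (dual_funP f) => lf cf; rewrite fineK ?opnorm_fin. Qed.

Lemma dual_normD (f g : dual) :
  dual_norm (f + g) <= dual_norm f + dual_norm g.
Proof.
rewrite -of_realD ler_of_real -lee_fin EFinD !dual_opnormE.
exact: opnormD.
Qed.

Lemma dual_normZ (a : K) (f : dual) : dual_norm (a *: f) = `|a| * dual_norm f.
Proof.
have le_norm b (g : dual) : dual_norm (b *: g) <= `|b| * dual_norm g.
  rewrite -(of_real_rnorm (b : K^o)) -of_realM ler_of_real -lee_fin EFinM.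
  by rewrite !dual_opnormE; exact: opnormZ_le.
apply/eqP; rewrite eq_le le_norm /=.
have [->|a0] := eqVneq a 0.
  rewrite normr0 mul0r -of_real0 ler_of_real.
  by rewrite -lee_fin dual_opnormE opnorm_ge0.
rewrite -ler_pdivlMl ?normr_gt0// -normfV.
by apply: le_trans (le_norm _ _); rewrite scalerA mulVf// scale1r.
Qed.

Lemma dual_norm_eq0 (f : dual) : dual_norm f = 0 -> f = 0.
Proof.
move=> /(congr1 (@re R k)); rewrite re_of_real -of_real0 re_of_real => f0.
apply: val_inj; apply: opnorm_eq0; first by case: (dual_funP f).
by rewrite -/(dual_fun f) -dual_opnormE f0.
Qed.

HB.instance Definition _ :=
  Lmodule_isNormed.Build K dual dual_normD dual_normZ dual_norm_eq0.

End Dual.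

Coercion dual_fun : dual >-> Funclass.

Section Subspace.
Context {R : realType} {k : scalar_kind} (V : normedModType (scalar_field R k)).
Notation K := (scalar_field R k).

Record lin_subspace := LinSubspace {
  lin_subspace_pred : V -> bool;
  lin_subspaceP : submod_closed lin_subspace_pred }.

Variable E : lin_subspace.

HB.instance Definition _ :=
  GRing.isSubmodClosed.Build K V (lin_subspace_pred E) (lin_subspaceP E).

Definition elements : Type := {x : V | x \in lin_subspace_pred E}.

HB.instance Definition _ := [isSub of elements for @sval _ _].
HB.instance Definition _ := [Choice of elements by <:].
HB.instance Definition _ := [SubChoice_isSubLmodule of elements by <:].

Definition elements_norm (x : elements) : K := `|\val x|.

Lemma elements_normD (x y : elements) :
  elements_norm (x + y) <= elements_norm x + elements_norm y.
Proof. exact: ler_normD. Qed.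

Lemma elements_normZ (a : K) (x : elements) :
  elements_norm (a *: x) = `|a| * elements_norm x.
Proof. exact: normrZ. Qed.

Lemma elements_norm_eq0 (x : elements) : elements_norm x = 0 -> x = 0.
Proof. by move=> /normr0_eq0 x0; apply: val_inj. Qed.

HB.instance Definition _ := Lmodule_isNormed.Build K elements
  elements_normD elements_normZ elements_norm_eq0.

End Subspace.

(* 'rV[K]_d with the Euclidean norm, in place of the sup norm that the library
   puts on matrices. *)
Section Euclidean.
Context (R : realType) (k : scalar_kind) (d : nat).
Notation K := (scalar_field R k).

Definition ell2 : Type := 'rV[K]_d.

HB.instance Definition _ := GRing.Lmodule.on ell2.

Definition ell2_rnorm (x : ell2) : R :=
  Num.sqrt (\sum_(i < d) rnorm (x ord0 i : K^o) ^+ 2).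

Definition ell2_norm (x : ell2) : K := of_real k (ell2_rnorm x).

Lemma sum_mul_le_sqrt (a b : 'I_d -> R) :
  \sum_i a i * b i <=
  Num.sqrt (\sum_i a i ^+ 2) * Num.sqrt (\sum_i b i ^+ 2).
Proof.
set A := \sum_i a i ^+ 2; set B := \sum_i b i ^+ 2; set C := \sum_i _.
have A0 : 0 <= A by apply: sumr_ge0 => i _; exact: sqr_ge0.
have B0 : 0 <= B by apply: sumr_ge0 => i _; exact: sqr_ge0.
suff CAB : C ^+ 2 <= A * B.
  by rewrite -sqrtrM// (le_trans (ler_norm _))// -sqrtr_sqr ler_wsqrtr.
have key t : 0 <= t ^+ 2 * A - 2 * t * C + B.
  have -> : t ^+ 2 * A - 2 * t * C + B = \sum_i (t * a i - b i) ^+ 2.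
    rewrite !mulr_sumr -sumrB -big_split /=; apply: eq_bigr => i _.
    by rewrite sqrrB exprMn -mulr_natl; ring.
  by apply: sumr_ge0 => i _; exact: sqr_ge0.
have [A_eq0|A_neq0] := eqVneq A 0.
  have C0 : C = 0.
    apply: big1 => i _; suff -> : a i = 0 by rewrite mul0r.
    apply/eqP; rewrite -sqrf_eq0; apply/eqP.
    move/eqP: A_eq0; rewrite psumr_eq0; last by move=> j _; exact: sqr_ge0.
    by move=> /allP/(_ i); rewrite mem_index_enum => /(_ isT)/eqP.
  by rewrite C0 expr0n mulr_ge0.
have A_gt0 : 0 < A by rewrite lt_neqAle eq_sym A_neq0.
have := key (C / A).
have -> : (C / A) ^+ 2 * A - 2 * (C / A) * C + B = (A * B - C ^+ 2) / A.
  by field.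
by rewrite pmulr_lge0 ?invr_gt0// subr_ge0.
Qed.

Lemma ell2_normD (x y : ell2) : ell2_norm (x + y) <= ell2_norm x + ell2_norm y.
Proof.
rewrite -of_realD ler_of_real /ell2_rnorm.
set a := fun i => rnorm (x ord0 i : K^o); set b := fun i => rnorm (y ord0 i : K^o).
rewrite -(ler_pXn2r (n := 2)) ?nnegrE ?addr_ge0 ?sqrtr_ge0//.
rewrite sqrrD !sqr_sqrtr; try by apply: sumr_ge0 => i _; exact: sqr_ge0.
apply: (@le_trans _ _ (\sum_i (a i + b i) ^+ 2)).
  apply: ler_sum => i _; rewrite mxE ler_pXn2r ?nnegrE ?addr_ge0 ?rnorm_ge0//.
  exact: rnormD.
under eq_bigr do rewrite sqrrD.
rewrite !big_split /= lerD2r lerD2l mulr2n.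
by apply: lerD; exact: sum_mul_le_sqrt.
Qed.

Lemma ell2_normZ (a : K) (x : ell2) : ell2_norm (a *: x) = `|a| * ell2_norm x.
Proof.
rewrite -(of_real_rnorm (a : K^o)) -of_realM; congr (of_real k _).
rewrite /ell2_rnorm -[X in X * _]ger0_norm ?rnorm_ge0// -sqrtr_sqr.
rewrite -sqrtrM ?sqr_ge0// mulr_sumr; congr Num.sqrt; apply: eq_bigr => i _.
by rewrite mxE -exprMn -rnormZ.
Qed.

Lemma ell2_norm_eq0 (x : ell2) : ell2_norm x = 0 -> x = 0.
Proof.
move=> /(congr1 (@re R k)); rewrite re_of_real -of_real0 re_of_real => /eqP.
rewrite sqrtr_eq0 => x0; apply/rowP => i; rewrite mxE.
apply: (@rnorm_eq0 R k K^o); apply/eqP; rewrite -sqrf_eq0.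
have /eqP : \sum_(i < d) rnorm (x ord0 i : K^o) ^+ 2 = 0.
  by apply/eqP; rewrite eq_le x0 sumr_ge0// => j _; exact: sqr_ge0.
rewrite psumr_eq0; last by move=> j _; exact: sqr_ge0.
by move=> /allP/(_ i); rewrite mem_index_enum => /(_ isT).
Qed.

HB.instance Definition _ :=
  Lmodule_isNormed.Build K ell2 ell2_normD ell2_normZ ell2_norm_eq0.

End Euclidean.

(* The algebraic tensor product by generators and relations: formal sums of
   pairs [:: (x_1, y_1); ...; (x_r, y_r)], modulo the congruence generated by
   commutativity and the bilinearity of the pairs. *)
Section TensorProduct.
Context (K : numFieldType) (X Y : lmodType K).
Implicit Types s t u : seq (X * Y).

Inductive tensor_rel : seq (X * Y) -> seq (X * Y) -> Prop :=
| tensor_refl s : tensor_rel s s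
| tensor_sym s t : tensor_rel s t -> tensor_rel t s
| tensor_trans s t u : tensor_rel s t -> tensor_rel t u -> tensor_rel s u
| tensor_cat s s' t t' :
    tensor_rel s s' -> tensor_rel t t' -> tensor_rel (s ++ t) (s' ++ t')
| tensor_comm s t : tensor_rel (s ++ t) (t ++ s)
| tensor_zero y : tensor_rel [:: (0, y)] [::]
| tensor_addl x x' y : tensor_rel [:: (x + x', y)] [:: (x, y); (x', y)]
| tensor_addr x y y' : tensor_rel [:: (x, y + y')] [:: (x, y); (x, y')]
| tensor_scale a x y : tensor_rel [:: (a *: x, y)] [:: (x, a *: y)].

Definition tensor_relb s t : bool := `[< tensor_rel s t >].

Lemma tensor_relb_refl : reflexive tensor_relb.
Proof. by move=> s; apply/asboolP; exact: tensor_refl. Qed.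

Lemma tensor_relb_sym : symmetric tensor_relb.
Proof. by move=> s t; apply/asboolP/asboolP; exact: tensor_sym. Qed.

Lemma tensor_relb_trans : transitive tensor_relb.
Proof.
move=> t s u /asboolP st /asboolP tu; apply/asboolP; exact: tensor_trans tu.
Qed.

Canonical tensor_equiv :=
  EquivRel tensor_relb tensor_relb_refl tensor_relb_sym tensor_relb_trans.

Definition tensor : Type := {eq_quot tensor_relb}.

HB.instance Definition _ := Choice.on tensor.
HB.instance Definition _ : EqQuotient _ tensor_relb tensor :=
  EqQuotient.on tensor.

Definition tensor_class s : tensor := \pi_tensor s.

Lemma tensor_classP s t : tensor_class s = tensor_class t <-> tensor_rel s t.
Proof.
split; first by move=> /eqquotP/asboolP.
by move=> st; apply/eqquotP/asboolP.
Qed.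

Lemma tensor_repr (w : tensor) : tensor_class (repr w) = w.
Proof. exact: reprK. Qed.

Definition formal_scale (a : K) s := [seq (a *: p.1, p.2) | p <- s].

Lemma formal_scale_rel (a : K) s t :
  tensor_rel s t -> tensor_rel (formal_scale a s) (formal_scale a t).
Proof.
rewrite /formal_scale; elim=> {s t} /=.
- by move=> s; exact: tensor_refl.
- by move=> s t _; exact: tensor_sym.
- by move=> s t u _ st _; exact: tensor_trans.
- by move=> s s' t t' _ ? _ ?; rewrite !map_cat; exact: tensor_cat.
- by move=> s t; rewrite !map_cat; exact: tensor_comm.
- by move=> y; rewrite scaler0; exact: tensor_zero.
- by move=> x x' y; rewrite scalerDr; exact: tensor_addl.
- by move=> x y y'; exact: tensor_addr.
- by move=> b x y; rewrite scalerA mulrC -scalerA; exact: tensor_scale.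
Qed.

Definition tensor_add (v w : tensor) : tensor :=
  tensor_class (repr v ++ repr w).

Definition tensor_scalar (a : K) (w : tensor) : tensor :=
  tensor_class (formal_scale a (repr w)).

Definition tensor_opp (w : tensor) : tensor := tensor_scalar (-1) w.

Lemma repr_class s : tensor_rel (repr (tensor_class s)) s.
Proof. by apply/tensor_classP; exact: tensor_repr. Qed.

Lemma tensor_addE s t :
  tensor_add (tensor_class s) (tensor_class t) = tensor_class (s ++ t).
Proof. by apply/tensor_classP/tensor_cat; exact: repr_class. Qed.

Lemma tensor_scalarE a s :
  tensor_scalar a (tensor_class s) = tensor_class (formal_scale a s).
Proof. by apply/tensor_classP/formal_scale_rel; exact: repr_class. Qed.

Lemma tensor_classW (P : tensor -> Prop) :
  (forall s, P (tensor_class s)) -> forall w, P w.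
Proof. by move=> Ps w; rewrite -(tensor_repr w). Qed.

Lemma tensor_addA : associative tensor_add.
Proof.
elim/tensor_classW => s; elim/tensor_classW => t; elim/tensor_classW => u.
by rewrite !tensor_addE catA.
Qed.

Lemma tensor_addC : commutative tensor_add.
Proof.
elim/tensor_classW => s; elim/tensor_classW => t; rewrite !tensor_addE.
by apply/tensor_classP; exact: tensor_comm.
Qed.

Lemma tensor_add0 : left_id (tensor_class [::]) tensor_add.
Proof. by elim/tensor_classW => s; rewrite tensor_addE. Qed.

Lemma tensor_scalarDl (w : tensor) (a b : K) :
  tensor_scalar (a + b) w = tensor_add (tensor_scalar a w) (tensor_scalar b w).
Proof.
elim/tensor_classW: w => s; rewrite !tensor_scalarE tensor_addE.
apply/tensor_classP; elim: s => [|[x y] s IHs] /=; first exact: tensor_refl.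
rewrite scalerDl.
have := tensor_cat (tensor_addl (a *: x) (b *: x) y) IHs.
move=> /tensor_trans; apply; rewrite /=.
apply: (@tensor_cat [:: (a *: x, y)] [:: (a *: x, y)]).
  exact: tensor_refl.
rewrite -cat1s catA -[X in tensor_rel _ (_ ++ X)]cat1s catA.
by apply: tensor_cat; [exact: tensor_comm|exact: tensor_refl].
Qed.

Lemma tensor_scalar0 (w : tensor) : tensor_scalar 0 w = tensor_class [::].
Proof.
elim/tensor_classW: w => s; rewrite tensor_scalarE; apply/tensor_classP.
elim: s => [|[x y] s IHs] /=; first exact: tensor_refl.
by rewrite scale0r; exact: (tensor_cat (tensor_zero y) IHs).
Qed.

Lemma tensor_scalar1 (w : tensor) : tensor_scalar 1 w = w.
Proof.
elim/tensor_classW: w => s; rewrite tensor_scalarE; congr tensor_class.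
by rewrite /formal_scale -[RHS]map_id; apply: eq_map => -[x y] /=; rewrite scale1r.
Qed.

Lemma tensor_scalarDr : right_distributive tensor_scalar tensor_add.
Proof.
move=> a; elim/tensor_classW => s; elim/tensor_classW => t.
by rewrite tensor_addE !tensor_scalarE tensor_addE /formal_scale map_cat.
Qed.

Lemma tensor_addN : left_inverse (tensor_class [::]) tensor_opp tensor_add.
Proof.
move=> w; rewrite -[X in tensor_add _ X]tensor_scalar1 /tensor_opp.
by rewrite -tensor_scalarDl addNr tensor_scalar0.
Qed.

HB.instance Definition _ := GRing.isZmodule.Build tensor
  tensor_addA tensor_addC tensor_add0 tensor_addN.

Lemma tensor_scalarA (a b : K) (w : tensor) :
  tensor_scalar a (tensor_scalar b w) = tensor_scalar (a * b) w.
Proof.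
elim/tensor_classW: w => s; rewrite !tensor_scalarE; congr tensor_class.
by rewrite /formal_scale -map_comp; apply: eq_map => -[x y] /=; rewrite scalerA.
Qed.

HB.instance Definition _ := GRing.Zmodule_isLmodule.Build K tensor
  tensor_scalarA tensor_scalar1 tensor_scalarDr tensor_scalarDl.

Definition elementary_tensor (x : X) (y : Y) : tensor :=
  tensor_class [:: (x, y)].

Lemma tensor_classE s :
  tensor_class s = \sum_(p <- s) elementary_tensor p.1 p.2.
Proof.
elim: s => [|[x y] s IHs]; first by rewrite big_nil.
by rewrite big_cons -IHs; exact: (esym (tensor_addE [:: (x, y)] s)).
Qed.

Lemma tensor_sumP (w : tensor) :
  exists s, w = \sum_(p <- s) elementary_tensor p.1 p.2.
Proof. by exists (repr w); rewrite -tensor_classE tensor_repr. Qed.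

(* A bilinear map takes the same value on all representations of a tensor. *)
Lemma tensor_bilinear (V : lmodType K) (B : X -> Y -> V) :
  (forall y, linear (B^~ y)) -> (forall x, linear (B x)) ->
  forall s t, \sum_(p <- s) elementary_tensor p.1 p.2 =
              \sum_(p <- t) elementary_tensor p.1 p.2 ->
  \sum_(p <- s) B p.1 p.2 = \sum_(p <- t) B p.1 p.2.
Proof.
move=> Bl Br s t; rewrite -!tensor_classE => /tensor_classP.
have Bl0 y : B 0 y = 0.
  by apply: (@addrI _ (B 0 y)); rewrite addr0 -{1}[B 0 y]scale1r -Bl scaler0 addr0.
have Br0 x : B x 0 = 0.
  by apply: (@addrI _ (B x 0)); rewrite addr0 -{1}[B x 0]scale1r -Br scaler0 addr0.
elim=> {s t}.
- by [].
- by move=> s t _ ->.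
- by move=> s t u _ -> _ ->.
- by move=> s s' t t' _ st _ st'; rewrite !big_cat st st'.
- by move=> s t; rewrite !big_cat /= addrC.
- by move=> y; rewrite big_seq1 big_nil.
- move=> x x' y; rewrite !big_cons !big_nil !addr0 /=.
  by rewrite -[x in LHS]scale1r Bl scale1r.
- move=> x y y'; rewrite !big_cons !big_nil !addr0 /=.
  by rewrite -[y in LHS]scale1r Br scale1r.
- move=> a x y; rewrite !big_seq1 /=.
  by rewrite -[a *: x]addr0 Bl Bl0 -[a *: y]addr0 Br Br0.
Qed.

End TensorProduct.

Notation "x ⊗ y" := (elementary_tensor x y)
  (at level 40, left associativity) : ring_scope.

Section TensorNorms.
Context {R : realType} {k : scalar_kind} (X Y : normedModType (scalar_field R k)).
Notation K := (scalar_field R k).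
Implicit Types w : tensor X Y.

(* The sum does not depend on the representation s of w, by
   [tensor_bilinear]. *)
Definition injective_norm w : \bar R :=
  ereal_sup [set z | exists (f : dual X) (g : dual Y) (s : seq (X * Y)),
    [/\ rnorm f <= 1, rnorm g <= 1, w = \sum_(p <- s) p.1 ⊗ p.2 &
      z = (rnorm (\sum_(p <- s) f p.1 * g p.2 : K^o))%:E]].

Definition projective_norm w : \bar R :=
  ereal_inf [set z | exists s : seq (X * Y),
    w = \sum_(p <- s) p.1 ⊗ p.2 /\
    z = (\sum_(p <- s) rnorm p.1 * rnorm p.2)%:E].

End TensorNorms.

(* Z, with the embedding j, is a completion of V for the norm p; this
   determines Z up to an isometric isomorphism that commutes with the
   embeddings. *)
Definition is_completion (R : realType) (k : scalar_kind)
    (V : lmodType (scalar_field R k)) (p : V -> \bar R)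
    (Z : completeNormedModType (scalar_field R k)) (j : {linear V -> Z}) : Prop :=
  (forall v, (rnorm (j v))%:E = p v) /\ dense (range j).

Definition CNJ (R : realType) (k : scalar_kind)
    (X : normedModType (scalar_field R k)) : \bar R :=
  ereal_sup [set ((rnorm (xy.1 + xy.2) ^+ 2 + rnorm (xy.1 - xy.2) ^+ 2) /
                  (2 * (rnorm xy.1 ^+ 2 + rnorm xy.2 ^+ 2)))%:E
            | xy in [set xy : X * X | xy != (0, 0)]].

(* If T is unbounded then the product is +oo, so the infimum is unaffected. *)
Definition banach_mazur (R : realType) (k : scalar_kind)
    (E F : normedModType (scalar_field R k)) : \bar R :=
  ereal_inf [set z | exists (T : {linear E -> F}) (S : {linear F -> E}),
    [/\ cancel T S, cancel S T & z = (opnorm T * opnorm S)%E]].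

Definition eta2 (R : realType) (k : scalar_kind)
    (X : normedModType (scalar_field R k)) : \bar R :=
  ereal_inf [set banach_mazur (elements E) (ell2 R k 2)
            | E in [set E : lin_subspace X | dim_eq (elements E) 2]].

(* Main.v *)
Require Import Defs.
From HB Require Import structures.
From mathcomp Require Import all_boot all_order all_algebra.
From mathcomp Require Import complex ring lra.
From mathcomp Require Import boolp classical_sets reals ereal.
From mathcomp Require Import topology normedtype.

Set Implicit Arguments.
Unset Strict Implicit.
Unset Printing Implicit Defensive.

Import Order.TTheory GRing.Theory Num.Theory.
Import numFieldNormedType.Exports.

Local Open Scope classical_set_scope.
Local Open Scope ring_scope.

(** The lower bounds by the constants of the factors hold because [x ⊗ y] has
    norm [‖x‖ ‖y‖] for both tensor norms, so that tensoring with a fixed unit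
    vector embeds each factor isometrically in the completion. That the norm of
    [x ⊗ y] is not smaller than [‖x‖ ‖y‖] is witnessed by norming functionals,
    hence by the Hahn-Banach theorem.

    The third bound comes from two explicit pairs in the tensor square of a
    Euclidean plane with orthonormal basis [e_0, e_1]. For [a = e_0 ⊗ e_0] and
    [b = e_1 ⊗ e_1] the injective (operator) norms of [a], [b], [a + b], [a - b]
    are all [1], so that the von Neumann-Jordan quotient of [(a + b, a - b)] is
    [2]; the projective (trace class) norms of [a + b] and [a - b] are [2], so
    that the quotient of [(a, b)] is [2]. Transporting the pair along
    isomorphisms [S : ell2 -> E] and [S' : ell2 -> F] onto planes of the factors
    divides the quotient by at most the square of [‖S‖ ‖T‖ ‖S'‖ ‖T'‖], where [T]
    and [T'] are the inverses.

    For the injective norm (lemmas [eta2_pair] and [injective_norm_diag_le]) the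
    planes lie in [X] and [Y]: a functional of norm at most [1] pulled back
    along [S] has Euclidean norm at most [‖S‖], and the Cauchy-Schwarz
    inequality bounds [a + b] and [a - b].

    For the projective norm (lemmas [eta2_dual_pair] and
    [le_projective_norm_diag]) the planes lie in the duals. They provide
    functionals [f_i = S e_i] and [g_i = S' e_i]; the tensor is built from
    vectors of [X] and [Y] that are biorthogonal to them and of norm about
    [‖T‖] and [‖T'‖]. Such vectors exist by Helly's theorem, which is the lemma
    [helly_biorthogonal]. The bilinear forms [f_0 g_0 ± f_1 g_1], bounded by
    [‖S‖ ‖S'‖] by Cauchy-Schwarz again, bound [a + b] and [a - b] from below. *)

(** * The Hahn-Banach theorem for seminorms *)

Lemma of_realN (R : realType) (k : scalar_kind) (a : R) :
  of_real k (- a) = - of_real k a.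
Proof. by case: k => //=; rewrite rmorphN. Qed.

(** Real multiples are taken through [of_real], so that a complex space need not
    be given a second, real, module structure. *)
Definition sublinear (R : realType) (k : scalar_kind)
    (V : lmodType (scalar_field R k)) (q : V -> R) : Prop :=
  (forall x y, q (x + y) <= q x + q y) /\
  (forall (t : R) x, 0 <= t -> q (of_real k t *: x) = t * q x).

Section Sublinear.
Context {R : realType} {k : scalar_kind} {V : lmodType (scalar_field R k)}.
Implicit Types (p q : V -> R) (x y : V).

Lemma sublinear_intro q : (forall x y, q (x + y) <= q x + q y) ->
  (forall (t : R) x, 0 < t -> q (of_real k t *: x) <= t * q x) -> sublinear q.
Proof.
move=> qD qZ.
have qZ_eq (t : R) x : 0 < t -> q (of_real k t *: x) = t * q x.
  move=> t0; apply/eqP; rewrite eq_le qZ//=.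
  have := qZ t^-1 (of_real k t *: x); rewrite invr_gt0 => /(_ t0).
  rewrite scalerA -of_realM mulVf ?gt_eqF// of_real1 scale1r.
  by rewrite -ler_pdivrMl ?invr_gt0// invrK.
split=> // t x; rewrite le_eqVlt => /predU1P[<-|]; last exact: qZ_eq.
rewrite of_real0 scale0r mul0r.
have := @qZ_eq 2 0 (ltr0Sn _ _); rewrite scaler0 => q0; lra.
Qed.

Lemma sublinear0 q : sublinear q -> q 0 = 0.
Proof. by move=> [_ /(_ 0 0 (lexx _))]; rewrite scaler0 mul0r. Qed.

Lemma sublinear_geN q x : sublinear q -> - q (- x) <= q x.
Proof.
by move=> qs; have := qs.1 x (- x); rewrite subrr sublinear0// => ?; lra.
Qed.

(** The infimum of a family need not be subadditive; it is when a sum of values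
    of two members is always bounded below by a value of some third member. This
    covers both the one-parameter family of [sublinear_descent] and the chains
    of [exists_minimal_sublinear]. *)
Lemma sublinear_inf (I : Type) (A : set I) (F : I -> V -> R) (m : V -> R) :
  A !=set0 -> (forall i x, A i -> m x <= F i x) ->
  (forall i j x y, A i -> A j -> exists2 l, A l & F l (x + y) <= F i x + F j y) ->
  (forall i (t : R) x, A i -> 0 < t ->
     exists2 l, A l & F l (of_real k t *: x) <= t * F i x) ->
  sublinear (fun x => inf [set F i x | i in A]).
Proof.
move=> [i0 Ai0] mF FD FZ.
have F0 x : [set F i x | i in A] !=set0 by exists (F i0 x), i0.
have Flb i x : A i -> inf [set F i x | i in A] <= F i x.
  move=> Ai; apply: ge_inf; last by exists i.
  by exists (m x) => _ [j Aj <-]; exact: mF.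
apply: sublinear_intro => [x y|t x t0].
- rewrite -lerBlDr; apply: lb_le_inf => // _ [i Ai <-].
  rewrite lerBlDl -lerBlDr; apply: lb_le_inf => // _ [j Aj <-].
  rewrite lerBlDl; have [l Al lij] := FD i j x y Ai Aj.
  exact: le_trans (Flb _ _ Al) _.
- rewrite -ler_pdivrMl//; apply: lb_le_inf => // _ [i Ai <-].
  rewrite ler_pdivrMl//; have [l Al li] := FZ i t x Ai t0.
  exact: le_trans (Flb _ _ Al) _.
Qed.

(** The functional [x |-> inf_(t >= 0) (q (x + t y) - t q y)] is the one. *)
Lemma sublinear_descent q y : sublinear q -> exists q',
  [/\ sublinear q', forall x, q' x <= q x & q' (- y) <= - q y].
Proof.
move=> qs; have [qD qZ] := qs.
pose F (t : R) x := q (x + of_real k t *: y) - t * q y.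
have mF (t : R) x : 0 <= t -> - q (- x) <= F t x.
  move=> t0; rewrite /F -qZ//.
  have := qD (x + of_real k t *: y) (- x); rewrite addrAC subrr add0r => ?; lra.
exists (fun x => inf [set F t x | t in [set t | 0 <= t]]).
have Flb t x : 0 <= t -> inf [set F t x | t in [set t | 0 <= t]] <= F t x.
  move=> t0; apply: ge_inf; last by exists t.
  by exists (- q (- x)) => _ [s s0 <-]; exact: mF.
split.
- apply: (@sublinear_inf _ _ _ (fun x => - q (- x))).
  + by exists 0 => /=.
  + by move=> t x; exact: mF.
  + move=> s t x x' s0 t0; exists (s + t); first exact: addr_ge0.
    rewrite /F of_realD scalerDl addrACA.
    have := qD (x + of_real k s *: y) (x' + of_real k t *: y); lra.
  + move=> s t x s0 t0; exists (t * s); first by rewrite /= mulr_ge0// ltW.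
    rewrite /F of_realM -scalerA -scalerDr qZ; last exact: ltW.
    by rewrite mulrBr mulrA.
- move=> x; apply: le_trans (Flb 0 x _) _ => //.
  by rewrite /F of_real0 scale0r addr0 mul0r subr0.
- apply: le_trans (Flb 1 _ ler01) _.
  by rewrite /F of_real1 scale1r addNr sublinear0// mul1r sub0r.
Qed.

(** Zorn's lemma applies because the members of a chain below [p] are bounded
    below by [x |-> - p (- x)]. *)
Lemma exists_minimal_sublinear p : sublinear p -> exists q,
  [/\ sublinear q, forall x, q x <= p x &
      forall q', sublinear q' -> (forall x, q' x <= q x) -> q' = q].
Proof.
move=> ps.
pose T := {q : V -> R | sublinear q /\ forall x, q x <= p x}.
pose below (q q' : T) : bool := `[< forall x, sval q' x <= sval q x >].
have [||||[q [qs qp]] q_min] := @Zorn T below.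
- by move=> q; apply/asboolP.
- move=> q q' q'' /asboolP qq' /asboolP q'q''; apply/asboolP => x.
  exact: le_trans (q'q'' x) (qq' x).
- move=> [q Pq] [q' Pq'] /asboolP/= qq' /asboolP/= q'q; apply: eq_exist.
  by apply/funext => x; apply/eqP; rewrite eq_le qq' q'q.
- move=> A A_total; have [A0|/nonemptyPn A0] := pselect (A !=set0); last first.
    by exists (exist _ p (conj ps (fun x => lexx (p x)))) => q; rewrite A0.
  have lbA (q : T) x : - p (- x) <= sval q x.
    case: q => q [/= qs qp]; apply: le_trans (sublinear_geN _ qs).
    by rewrite lerN2.
  pose m x := inf [set sval (q : T) x | q in A].
  have infA (q : T) x : A q -> m x <= sval q x.
    move=> Aq; apply: ge_inf; last by exists q.
    by exists (- p (- x)) => _ [q' _ <-].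
  have infs : sublinear m.
    apply: (@sublinear_inf _ _ _ (fun x => - p (- x))) => //.
    + move=> q q' x y Aq Aq'.
      have [/asboolP qq'|/asboolP qq'] := A_total q q' Aq Aq'.
      * exists q' => //; apply: le_trans ((svalP q').1.1 x y) _.
        by rewrite lerD2r.
      * exists q => //; apply: le_trans ((svalP q).1.1 x y) _.
        by rewrite lerD2l.
    + by move=> q t x Aq t0; exists q => //; rewrite (svalP q).1.2// ltW.
  have infp x : m x <= p x.
    by have [q Aq] := A0; apply: le_trans (infA q x Aq) ((svalP q).2 x).
  exists (exist _ m (conj infs infp)) => q Aq; apply/asboolP => x /=.
  exact: infA.
- exists q; split=> // q' q's q'q.
  have q'p x : q' x <= p x by exact: le_trans (q'q x) (qp x).
  by have [] := q_min (exist _ q' (conj q's q'p)) (asboolT q'q).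
Qed.

(** Descent in the direction [x] cannot change a minimal [q], hence
    [q (- x) = - q x], and an odd subadditive function is additive. *)
Lemma minimal_sublinear_additive q : sublinear q ->
  (forall q', sublinear q' -> (forall x, q' x <= q x) -> q' = q) ->
  (forall x y, q (x + y) = q x + q y) /\
  (forall (t : R) x, q (of_real k t *: x) = t * q x).
Proof.
move=> qs q_min.
have qN x : q (- x) = - q x.
  have [q' [q's q'q q'x]] := sublinear_descent x qs.
  move: q'x; rewrite (q_min q' q's q'q) => qx.
  by have := sublinear_geN x qs; lra.
split=> [x y|t x].
  apply/eqP; rewrite eq_le qs.1/=.
  by have := qs.1 (- x) (- y); rewrite -opprD !qN; lra.
have [t0|t0] := leP 0 t; first exact: qs.2.
have := qs.2 (- t) x; rewrite oppr_ge0 => /(_ (ltW t0)).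
by rewrite of_realN scaleNr qN mulNr => /oppr_inj.
Qed.

(** Descent along [x0] beforehand replaces [p] by some [p'] with
    [p' (- x0) <= - p x0]; below [p'], a linear functional is at least [p x0]
    at [x0]. *)
Lemma real_hahn_banach p x0 : sublinear p -> exists g : V -> R,
  [/\ forall x y, g (x + y) = g x + g y,
      forall (t : R) x, g (of_real k t *: x) = t * g x,
      forall x, g x <= p x & g x0 = p x0].
Proof.
move=> ps; have [p' [p's p'p p'x0]] := sublinear_descent x0 ps.
have [g [gs gp' g_min]] := exists_minimal_sublinear p's.
have [gD gZ] := minimal_sublinear_additive gs g_min.
exists g; split=> // [x|]; first exact: le_trans (p'p x).
apply/eqP; rewrite eq_le (le_trans (gp' x0))//=.
have := sublinear_geN x0 gs; have := gp' (- x0); lra.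
Qed.

End Sublinear.

Section ScalarFacts.
Context {R : realType} {k : scalar_kind}.
Notation K := (scalar_field R k).

Lemma re_le_rnorm (z : K^o) : re z <= rnorm z.
Proof.
rewrite /rnorm; move: z; case: k => /= [z|z]; first exact: ler_norm.
case: z => a b /=.
by rewrite (le_trans (ler_norm a))// -sqrtr_sqr ler_wsqrtr// lerDl sqr_ge0.
Qed.

Lemma rnorm_eq1 (u : K^o) : `|u| = 1 -> rnorm u = 1.
Proof. by rewrite /rnorm => ->; rewrite -of_real1 re_of_real. Qed.

Lemma exists_phase (z : K^o) :
  exists2 u : K^o, rnorm u = 1 & u * z = of_real k (rnorm z).
Proof.
rewrite of_real_rnorm; have [->|z0] := eqVneq z 0.
  by exists 1; rewrite ?mulr0 ?normr0//; apply: rnorm_eq1; rewrite normr1.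
exists (`|z| / z); last by rewrite divfK.
by apply: rnorm_eq1; rewrite normf_div normr_id divff// normr_eq0.
Qed.

(** Over the complex numbers the functional is [x |-> g x - i g (i x)]. *)
Lemma re_lift (V : lmodType K) (g : V -> R) :
  (forall x y, g (x + y) = g x + g y) ->
  (forall (t : R) x, g (of_real k t *: x) = t * g x) ->
  exists f : V -> K^o, linear f /\ forall x, re (f x) = g x.
Proof.
move: V g; case: k => /= V g gD gZ.
  by exists g; split=> // a x y; rewrite gD gZ.
pose i : R[i] := (0 +i* 1)%C.
pose f x : R[i] := (g x +i* (- g (i *: x)))%C.
exists f; split=> // a x y.
have gZC (b : R[i]) z : g (b *: z) = complex.Re b * g z + complex.Im b * g (i *: z).
  have bE : b = (complex.Re b)%:C%C + (complex.Im b)%:C%C * i.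
    by case: b => rb ib; apply/eqP; rewrite eq_complex /=; apply/andP; split;
      apply/eqP; ring.
  by rewrite [in LHS]bE scalerDl -scalerA gD !gZ.
apply/eqP; rewrite eq_complex /=; apply/andP; split; apply/eqP.
  by rewrite gD gZC; case: (a) => ra ia /=; ring.
rewrite scalerDr gD scalerA mulrC -scalerA [g (a *: (i *: x))]gZC scalerA gZC /=.
by case: (a) => ra ia /=; ring.
Qed.

(** The real functional [g] below [p] bounds the real part only; rotating [x] by
    the phase of [f x] makes [f x] real without changing [p x]. *)
Lemma hahn_banach_seminorm (V : lmodType K) (p : V -> R) (x0 : V) :
  (forall x y, p (x + y) <= p x + p y) ->
  (forall (a : K) x, p (a *: x) <= rnorm (a : K^o) * p x) ->
  exists f : V -> K^o,
    [/\ linear f, forall x, rnorm (f x) <= p x & rnorm (f x0) = p x0].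
Proof.
move=> pD pZ; have ps : sublinear p.
  apply: sublinear_intro => // t x t0.
  by rewrite (le_trans (pZ _ _))// rnorm_of_real// ltW.
have [g [gD gZ gp gx0]] := real_hahn_banach x0 ps.
have [f [fl fg]] := re_lift gD gZ.
have f_le x : rnorm (f x) <= p x.
  have [u u1 ux] := exists_phase (f x).
  have : g (u *: x) <= p x.
    by rewrite (le_trans (gp _))// (le_trans (pZ _ _))// u1 mul1r.
  apply: le_trans.
  rewrite -fg -[u *: x]addr0 fl -[rnorm (f x)](@re_of_real _ k) -ux.
  suff -> : f 0 = 0 by rewrite addr0.
  by have := fl (-1) 0 0; rewrite scaler0 addr0 scaleN1r addNr.
exists f; split=> //; apply/eqP; rewrite eq_le f_le /= -gx0 -fg.
exact: re_le_rnorm.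
Qed.

End ScalarFacts.

(** * Bounded functionals and tensor norms *)

Section BoundedFunctionals.
Context {R : realType} {k : scalar_kind}.
Notation K := (scalar_field R k).

Lemma rnorm_gt0 (V : normedModType K) (x : V) : x != 0 -> 0 < rnorm x.
Proof.
move=> x0; rewrite lt_neqAle rnorm_ge0 andbT eq_sym.
by apply: contraNneq x0 => /rnorm_eq0 ->.
Qed.

Lemma rnorm_sum (V : normedModType K) (I : Type) (s : seq I) (F : I -> V) :
  rnorm (\sum_(i <- s) F i) <= \sum_(i <- s) rnorm (F i).
Proof.
elim: s => [|i s IHs]; first by rewrite !big_nil rnorm0.
by rewrite !big_cons (le_trans (rnormD _ _))// lerD2l.
Qed.

Lemma rnorm_mul (a b : K^o) : rnorm (a * b : K^o) = rnorm a * rnorm b.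
Proof. exact: rnormZ. Qed.

Lemma opnorm_le (V W : normedModType K) (f : V -> W) (c : R) : 0 <= c ->
  (forall x, rnorm (f x) <= c * rnorm x) -> (opnorm f <= c%:E)%E.
Proof.
move=> c0 fc; apply: ge_ereal_sup => _ [x /= x1 <-]; rewrite lee_fin.
by apply: le_trans (fc x) _; rewrite ler_piMr.
Qed.

Lemma le_opnorm (V W : normedModType K) (f : {linear V -> W}) (c : R) x :
  (opnorm f <= c%:E)%E -> rnorm (f x) <= c * rnorm x.
Proof.
move=> fc; have [->|x0] := eqVneq x 0; first by rewrite linear0 !rnorm0 mulr0.
have rx0 := rnorm_gt0 x0.
have := @opnorm_ub _ _ _ _ f (of_real k (rnorm x)^-1 *: x).
rewrite linearZ /= !rnormZ rnorm_of_real ?invr_ge0 ?rnorm_ge0//.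
rewrite mulVf ?gt_eqF// => /(_ (lexx _)) /le_trans /(_ fc).
by rewrite lee_fin ler_pdivrMl// mulrC.
Qed.

Lemma dual_rnormE (X : normedModType K) (f : dual X) :
  (rnorm f)%:E = opnorm f.
Proof. by rewrite -dual_opnormE; congr (_%:E); exact: re_of_real. Qed.

Lemma dual_linear (X : normedModType K) (f : dual X) : linear f.
Proof. by case: (dual_funP f). Qed.

HB.instance Definition _ (X : normedModType K) (f : dual X) :=
  GRing.isLinear.Build K X K^o _ (dual_fun f) (dual_linear f).

Lemma dual_rnorm_ub (X : normedModType K) (f : dual X) x :
  rnorm (f x) <= rnorm f * rnorm x.
Proof. by apply: le_opnorm; rewrite dual_rnormE. Qed.

Lemma dual_ball_ub (X : normedModType K) (f : dual X) x :
  rnorm f <= 1 -> rnorm (f x) <= rnorm x.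
Proof.
by move=> f1; rewrite (le_trans (dual_rnorm_ub _ _))// ler_piMl ?rnorm_ge0.
Qed.

Lemma bounded_linear_dual (X : normedModType K) (f : X -> K^o) (c : R) :
  linear f -> 0 <= c -> (forall x, rnorm (f x) <= c * rnorm x) ->
  exists2 g : dual X, g =1 f & rnorm g <= c.
Proof.
move=> fl c0 fc.
pose F : {linear X -> K^o} := HB.pack f (GRing.isLinear.Build _ _ _ _ f fl).
have fb : bounded_near F (nbhs (0 : X)).
  apply/linear_boundedP; near=> M => x; rewrite -!of_real_rnorm.
  apply: (@le_trans _ _ (of_real k (c * rnorm x))).
    by rewrite ler_of_real fc.
  rewrite of_realM ler_wpM2r//; first by rewrite -of_real0 ler_of_real rnorm_ge0.
  by near: M; apply: nbhs_pinfty_ge; rewrite realE -of_real0 ler_of_real c0.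
have fP : f \in @dual_pred R k X.
  by apply/asboolP; split=> //; exact: (@linear_bounded_continuous _ _ _ F).1.
exists (exist _ f fP) => //.
by rewrite -lee_fin dual_rnormE; exact: opnorm_le.
Unshelve. all: by end_near.
Qed.

Lemma norming_functional (X : normedModType K) (x : X) :
  exists2 f : dual X, rnorm f <= 1 & rnorm (f x) = rnorm x.
Proof.
have rZ (a : K) (y : X) : rnorm (a *: y) <= rnorm (a : K^o) * rnorm y.
  by rewrite rnormZ.
have [f [fl f1 fx]] := hahn_banach_seminorm x (@rnormD R k X) rZ.
have [|g gf g1] := @bounded_linear_dual X f 1 fl ler01.
  by move=> y; rewrite mul1r.
by exists g => //; rewrite gf.
Qed.

End BoundedFunctionals.

Section TensorNormBounds.
Context {R : realType} {k : scalar_kind} {X Y : normedModType (scalar_field R k)}.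
Notation K := (scalar_field R k).
Implicit Types (s : seq (X * Y)).

Lemma tensorDl (x x' : X) (y : Y) : (x + x') ⊗ y = x ⊗ y + x' ⊗ y.
Proof.
transitivity (tensor_class [:: (x, y); (x', y)]).
  by apply/tensor_classP; exact: tensor_addl.
by rewrite tensor_classE big_cons big_seq1.
Qed.

Lemma tensorDr (x : X) (y y' : Y) : x ⊗ (y + y') = x ⊗ y + x ⊗ y'.
Proof.
transitivity (tensor_class [:: (x, y); (x, y')]).
  by apply/tensor_classP; exact: tensor_addr.
by rewrite tensor_classE big_cons big_seq1.
Qed.

Lemma tensorZl (a : K) (x : X) (y : Y) : (a *: x) ⊗ y = a *: (x ⊗ y).
Proof. by rewrite /elementary_tensor [RHS]tensor_scalarE. Qed.

Lemma tensorZr (a : K) (x : X) (y : Y) : x ⊗ (a *: y) = a *: (x ⊗ y).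
Proof.
by rewrite -tensorZl; apply/tensor_classP; apply: tensor_sym; exact: tensor_scale.
Qed.

Lemma functional_product_bilinear (f : dual X) (g : dual Y) :
  (forall y, linear ((fun x y => f x * g y : K^o)^~ y)) /\
  (forall x, linear ((fun x y => f x * g y : K^o) x)).
Proof.
split=> [y a x x'|x a y y']; first by rewrite linearP mulrDl scalerAl.
by rewrite linearP mulrDr scalerAr.
Qed.

Lemma le_injective_norm (f : dual X) (g : dual Y) s :
  rnorm f <= 1 -> rnorm g <= 1 ->
  ((rnorm (\sum_(p <- s) f p.1 * g p.2 : K^o))%:E <=
   injective_norm (\sum_(p <- s) p.1 ⊗ p.2)%R)%E.
Proof. by move=> f1 g1; apply: ereal_sup_ubound; exists f, g, s. Qed.

(** One representation of the tensor is enough, since [f ⊗ g] takes the same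
    value on all of them. *)
Lemma injective_norm_le s (c : R) :
  (forall (f : dual X) (g : dual Y), rnorm f <= 1 -> rnorm g <= 1 ->
     rnorm (\sum_(p <- s) f p.1 * g p.2 : K^o) <= c) ->
  (injective_norm (\sum_(p <- s) p.1 ⊗ p.2)%R <= c%:E)%E.
Proof.
move=> sc; apply: ge_ereal_sup => _ [f [g [s' [f1 g1 ss' ->]]]]; rewrite lee_fin.
have [Bl Br] := functional_product_bilinear f g.
by rewrite -(tensor_bilinear Bl Br ss'); exact: sc.
Qed.

Lemma projective_norm_le s :
  (projective_norm (\sum_(p <- s) p.1 ⊗ p.2)%R <=
   (\sum_(p <- s) rnorm p.1 * rnorm p.2)%:E)%E.
Proof. by apply: ereal_inf_lbound; exists s. Qed.

(** A bilinear form bounded by [c] extends to a functional of norm at most [c]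
    for the projective norm. *)
Lemma le_projective_norm s (B : X -> Y -> K^o) (c : R) :
  (forall y, linear (B^~ y)) -> (forall x, linear (B x)) -> 0 < c ->
  (forall x y, rnorm (B x y) <= c * (rnorm x * rnorm y)) ->
  ((rnorm (\sum_(p <- s) B p.1 p.2 : K^o) / c)%:E <=
   projective_norm (\sum_(p <- s) p.1 ⊗ p.2)%R)%E.
Proof.
move=> Bl Br c0 Bc; apply: le_ereal_inf_tmp => _ [s' [ss' ->]]; rewrite lee_fin.
rewrite (tensor_bilinear Bl Br ss') ler_pdivrMr// mulrC mulr_sumr.
by apply: le_trans (rnorm_sum _ _) _; apply: ler_sum.
Qed.

Lemma injective_norm_elementary (x : X) (y : Y) :
  injective_norm (x ⊗ y) = (rnorm x * rnorm y)%:E.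
Proof.
have xyE : x ⊗ y = \sum_(p <- [:: (x, y)]) p.1 ⊗ p.2 by rewrite big_seq1.
apply/eqP; rewrite eq_le; apply/andP; split.
  rewrite xyE; apply: injective_norm_le => f g f1 g1; rewrite big_seq1 rnorm_mul.
  by rewrite ler_pM ?rnorm_ge0 ?dual_ball_ub.
have [f f1 <-] := norming_functional x; have [g g1 <-] := norming_functional y.
rewrite xyE -rnorm_mul.
by have := le_injective_norm [:: (x, y)] f1 g1; rewrite big_seq1.
Qed.

Lemma projective_norm_elementary (x : X) (y : Y) :
  projective_norm (x ⊗ y) = (rnorm x * rnorm y)%:E.
Proof.
have xyE : x ⊗ y = \sum_(p <- [:: (x, y)]) p.1 ⊗ p.2 by rewrite big_seq1.
apply/eqP; rewrite eq_le; apply/andP; split.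
  by have := projective_norm_le [:: (x, y)]; rewrite !big_seq1.
have [f f1 <-] := norming_functional x; have [g g1 <-] := norming_functional y.
have [Bl Br] := functional_product_bilinear f g.
have := @le_projective_norm [:: (x, y)] _ 1 Bl Br ltr01.
rewrite !big_seq1 divr1 rnorm_mul; apply => x' y'; rewrite mul1r rnorm_mul.
by rewrite ler_pM ?rnorm_ge0 ?dual_ball_ub.
Qed.

End TensorNormBounds.

(** * Euclidean coordinates and the Banach-Mazur distance to a plane *)

Section EuclideanCoordinates.
Context {R : realType} {k : scalar_kind}.
Notation K := (scalar_field R k).

Definition unit_vec d (i : 'I_d) : ell2 R k d := delta_mx ord0 i.

Definition coord_vec d (a : 'I_d -> K) : ell2 R k d := \row_i a i.

Lemma coord_vecE d (a : 'I_d -> K) : coord_vec a = \sum_i a i *: unit_vec i.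
Proof.
rewrite [LHS](row_sum_delta (coord_vec a)).
by apply: eq_bigr => i _; rewrite mxE.
Qed.

Lemma ell2_vecE d (v : ell2 R k d) : v = coord_vec (fun i => v ord0 i).
Proof. by apply/rowP => i; rewrite mxE. Qed.

Lemma rnorm_coord_vec d (a : 'I_d -> K) :
  rnorm (coord_vec a) = Num.sqrt (\sum_i rnorm (a i : K^o) ^+ 2).
Proof.
rewrite /rnorm [LHS](@re_of_real R k); congr Num.sqrt; apply: eq_bigr => i _.
by rewrite mxE.
Qed.

Lemma rnorm_unit_vec d (i : 'I_d) : rnorm (unit_vec i) = 1.
Proof.
rewrite [unit_vec i]ell2_vecE rnorm_coord_vec (bigD1 i)//= mxE !eqxx.
rewrite -of_real1 rnorm_of_real// big1 ?addr0 ?expr1n ?sqrtr1// => j ji.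
by rewrite mxE eqxx (negPf ji) rnorm0 expr0n.
Qed.

Lemma rnorm_coord d (a : 'I_d -> K) i : rnorm (a i : K^o) <= rnorm (coord_vec a).
Proof.
rewrite rnorm_coord_vec -[leLHS]ger0_norm ?rnorm_ge0// -sqrtr_sqr ler_wsqrtr//.
by rewrite (bigD1 i)//= lerDl sumr_ge0// => j _; exact: sqr_ge0.
Qed.

Lemma unit_vec_neq0 d (i : 'I_d) : unit_vec i != 0.
Proof.
apply/eqP => ui0; have := rnorm_unit_vec i.
by rewrite ui0 rnorm0 => /eqP; rewrite eq_sym oner_eq0.
Qed.

(** The scalar is the complex conjugate of [z]. *)
Lemma exists_square_phase (z : K^o) :
  exists2 w : K^o, rnorm w = rnorm z & w * z = of_real k (rnorm z ^+ 2).
Proof.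
have [u u1 uz] := exists_phase z; exists (of_real k (rnorm z) * u).
  by rewrite rnorm_mul u1 mulr1 rnorm_of_real ?rnorm_ge0.
by rewrite -mulrA uz -of_realM.
Qed.

(** Test [f] on the vector of the conjugates of its own coefficients. *)
Lemma ell2_functional_le d (f : ell2 R k d -> K^o) (c : R) : linear f ->
  (forall v, rnorm (f v) <= c * rnorm v) ->
  \sum_i rnorm (f (unit_vec i)) ^+ 2 <= c ^+ 2.
Proof.
move=> fl fc.
pose F : {linear ell2 R k d -> K^o} := HB.pack f (GRing.isLinear.Build _ _ _ _ f fl).
set N := \sum_i _.
have N0 : 0 <= N by apply: sumr_ge0 => i _; exact: sqr_ge0.
have /choice[w wP] (i : 'I_d) : exists w : K^o,
    rnorm w = rnorm (f (unit_vec i)) /\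
    w * f (unit_vec i) = of_real k (rnorm (f (unit_vec i)) ^+ 2).
  by have [w] := exists_square_phase (f (unit_vec i)); exists w.
have wN : rnorm (coord_vec w) = Num.sqrt N.
  by rewrite rnorm_coord_vec; congr Num.sqrt; apply: eq_bigr => i _; rewrite (wP i).1.
have fw : f (coord_vec w) = of_real k N.
  transitivity (F (coord_vec w)) => //; rewrite coord_vecE linear_sum.
  rewrite (big_morph (of_real k) (@of_realD R k) (@of_real0 R k)).
  by apply: eq_bigr => i _; rewrite -(wP i).2; rewrite linearZ.
have := fc (coord_vec w); rewrite fw wN rnorm_of_real// -{1}(sqr_sqrtr N0).
have [sN0|s0] := eqVneq (Num.sqrt N) 0.
  by move=> _; rewrite -(sqr_sqrtr N0) sN0 expr0n sqr_ge0.
rewrite expr2 ler_pM2r; last by rewrite lt_neqAle eq_sym s0 sqrtr_ge0.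
move=> Nc; rewrite -(sqr_sqrtr N0) ler_sqr// nnegrE ?sqrtr_ge0//.
exact: le_trans (sqrtr_ge0 N) Nc.
Qed.

End EuclideanCoordinates.

Section BanachMazur.
Context {R : realType} {k : scalar_kind}.
Notation K := (scalar_field R k).

Lemma opnorm_gt0 (E F : normedModType K) (T : {linear E -> F}) x :
  T x != 0 -> (0 < opnorm T)%E.
Proof.
move=> Tx; rewrite lt_neqAle opnorm_ge0 andbT eq_sym.
apply/eqP => /(opnorm_eq0 (@linearP _ _ _ _ T)) T0.
by move: Tx; rewrite T0 eqxx.
Qed.

(** Positivity excludes the convention [0 * +oo = 0] in the product of the two
    operator norms. *)
Lemma iso_opnorm_gt0 (E F : normedModType K) (T : {linear E -> F})
    (S : {linear F -> E}) (v : F) : v != 0 -> cancel S T ->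
  (0 < opnorm T)%E /\ (0 < opnorm S)%E.
Proof.
move=> v0 ST; have Sv0 : S v != 0.
  by apply: contraNneq v0 => Sv; rewrite -(ST v) Sv linear0.
by split; [apply: (@opnorm_gt0 _ _ _ (S v)); rewrite ST|exact: opnorm_gt0 Sv0].
Qed.

Lemma iso_opnorm_ge1 (E F : normedModType K) (T : {linear E -> F})
    (S : {linear F -> E}) (v : F) : v != 0 -> cancel S T ->
  (1 <= opnorm T * opnorm S)%E.
Proof.
move=> v0 ST; have [T0 S0] := iso_opnorm_gt0 v0 ST.
case: (opnorm T) (@le_opnorm _ _ _ _ T) T0 => [t| |]// tP t0; last first.
  by rewrite gt0_mulye// leey.
case: (opnorm S) (@le_opnorm _ _ _ _ S) S0 => [s| |]// sP s0; last first.
  by rewrite gt0_muley// leey.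
rewrite -EFinM lee_fin; have v_gt0 := rnorm_gt0 v0.
rewrite -(ler_pM2r v_gt0) mul1r -{1}(ST v) -mulrA.
apply: le_trans (tP t _ (lexx _)) _.
by rewrite ler_pM2l//; exact: sP.
Qed.

Lemma eta2_ge1 (X : normedModType K) : (1 <= eta2 X)%E.
Proof.
apply: le_ereal_inf_tmp => _ [E _ <-]; apply: le_ereal_inf_tmp => _ [T [S [_ ST ->]]].
exact: iso_opnorm_ge1 (unit_vec_neq0 (@ord0 1)) ST.
Qed.

Lemma eta2_lt (X : normedModType K) (r : R) : (eta2 X < r%:E)%E ->
  exists (E : lin_subspace X) (T : {linear elements E -> ell2 R k 2})
      (S : {linear ell2 R k 2 -> elements E}) (s t : R),
    [/\ cancel S T, 0 < s /\ 0 < t, s * t < r,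
        forall x, rnorm (T x) <= t * rnorm x & forall v, rnorm (S v) <= s * rnorm v].
Proof.
move=> /ereal_inf_lt[_ [E _ <-]] /ereal_inf_lt[_ [T [S [TS ST ->]]]] TSr.
exists E, T, S.
have [T0 S0] := iso_opnorm_gt0 (unit_vec_neq0 (@ord0 1)) ST.
case: (opnorm T) (@le_opnorm _ _ _ _ T) T0 TSr => [t| |]// tP t0; last first.
  by rewrite gt0_mulye// ltNge leey.
case: (opnorm S) (@le_opnorm _ _ _ _ S) S0 => [s| |]// sP s0; last first.
  by rewrite gt0_muley// ltNge leey.
rewrite -EFinM lte_fin => tsr; exists s, t; split=> //; first by rewrite mulrC.
- by move=> x; exact: tP.
- by move=> v; exact: sP.
Qed.

End BanachMazur.

(** * Biorthogonal systems and the theorem of Helly *)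

Section Biorthogonal.
Context {R : realType} {k : scalar_kind} {X : normedModType (scalar_field R k)}.
Notation K := (scalar_field R k).

Definition biorthogonal n (f : 'I_n -> dual X) (x : 'I_n -> X) : Prop :=
  forall i j, f i (x j) = (i == j)%:R.

Lemma dual_ext (f g : dual X) : f =1 g -> f = g.
Proof. by move=> fg; apply: val_inj; apply/funext. Qed.

Lemma dualD (f g : dual X) x : dual_fun (f + g) x = f x + g x.
Proof. by []. Qed.

Lemma dualB (f g : dual X) x : dual_fun (f - g) x = f x - g x.
Proof. by []. Qed.

Lemma dualZ (a : K) (f : dual X) x : dual_fun (a *: f) x = a * f x.
Proof. by []. Qed.

Lemma dual_sum (I : Type) (s : seq I) (F : I -> dual X) x :
  dual_fun (\sum_(i <- s) F i) x = \sum_(i <- s) F i x.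
Proof.
by elim: s => [|i s IHs]; rewrite ?big_nil// !big_cons dualD IHs.
Qed.

(** Induction: given vectors [z] biorthogonal to the functionals other than
    [f ord0], subtracting from [f ord0] a combination of those other functionals
    leaves a nonzero functional [g] that vanishes on [z]. *)
Lemma free_biorthogonal n (f : 'I_n -> dual X) : free_family f ->
  exists z, biorthogonal f z.
Proof.
elim: n f => [|n IHn] f f_free; first by exists (fun=> 0) => -[].
have [|z zP] := IHn (fun i => f (lift ord0 i)).
  move=> c c0 i; have := f_free (fun j => oapp c 0 (unlift ord0 j)).
  rewrite big_ord_recl unlift_none scale0r add0r.
  under eq_bigr do rewrite liftK.
  by move=> /(_ c0 (lift ord0 i)); rewrite liftK.
pose g : dual X := f ord0 - \sum_i f ord0 (z i) *: f (lift ord0 i).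
have [v gv0] : exists v, g v != 0.
  apply: contrapT => g_eq0; have g0 : g = 0.
    by apply: dual_ext => v; apply/eqP/negPn/negP => gv; apply: g_eq0; exists v.
  have := f_free (fun j => oapp (fun i => - f ord0 (z i)) 1 (unlift ord0 j)).
  rewrite big_ord_recl unlift_none scale1r.
  under eq_bigr do rewrite liftK scaleNr.
  rewrite sumrN => /(_ g0 ord0); rewrite unlift_none /= => /eqP.
  by rewrite oner_eq0.
(* A multiple of the projection of [v], along the [z i], to the common kernel
   of the functionals [f (lift ord0 i)]. *)
pose w := (g v)^-1 *: (v - \sum_i f (lift ord0 i) v *: z i).
have fw i : f (lift ord0 i) w = 0.
  rewrite linearZ linearB linear_sum /= (bigD1 i)//= linearZ /= zP eqxx.
  rewrite big1 => [|j ji]; last by rewrite linearZ /= zP eq_sym (negPf ji) scaler0.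
  by rewrite addr0 /GRing.scale /= mulr1 subrr mulr0.
have f0w : f ord0 w = 1.
  rewrite linearZ linearB linear_sum /=.
  suff -> : f ord0 v - \sum_i f ord0 (f (lift ord0 i) v *: z i) = g v.
    by rewrite /GRing.scale /= mulVf.
  rewrite /g dualB dual_sum; congr (_ - _).
  by apply: eq_bigr => i _; rewrite linearZ dualZ mulrC.
exists (fun j => oapp (fun i => z i - f ord0 (z i) *: w) w (unlift ord0 j)).
move=> i j; case: (unliftP ord0 j) => [j' ->|->];
  case: (unliftP ord0 i) => [i' ->|->]; rewrite ?unlift_none ?liftK /=.
- rewrite linearB linearZ /= zP fw scaler0 subr0.
  by rewrite (inj_eq lift_inj).
- by rewrite linearB linearZ /= f0w /GRing.scale /= mulr1 subrr.
- by rewrite fw.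
- exact: f0w.
Qed.

(** By Hahn-Banach, the distance [q (z j)] from [z j] to the common kernel of
    the [f i] is attained as [|g (z j)|] for a functional [g] of norm at most [1]
    vanishing on that kernel. Such a [g] is the combination
    [\sum_i g (z i) *: f i], and the hypothesis says that the coefficients of
    combinations in the unit ball are at most [c]. *)
Lemma helly_biorthogonal n (f : 'I_n -> dual X) (c c' : R) :
  free_family f -> c < c' ->
  (forall b : 'I_n -> K, rnorm (\sum_i b i *: f i) <= 1 ->
     forall i, rnorm (b i : K^o) <= c) ->
  exists2 x, biorthogonal f x & forall i, rnorm (x i) <= c'.
Proof.
move=> /free_biorthogonal[z zP] cc' bc.
pose fiber x := [set rnorm y | y in [set y | forall i, f i y = f i x]].
pose q x := inf (fiber x).
have fiber0 x : fiber x !=set0 by exists (rnorm x), x.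
have fiber_lb x : has_lbound (fiber x).
  by exists 0 => _ [y _ <-]; exact: rnorm_ge0.
have q_le x y : (forall i, f i y = f i x) -> q x <= rnorm y.
  by move=> yx; apply: ge_inf => //; exists y.
have qD x y : q (x + y) <= q x + q y.
  rewrite -lerBlDr; apply: lb_le_inf => // _ [x' x'P <-].
  rewrite lerBlDl -lerBlDr; apply: lb_le_inf => // _ [y' y'P <-].
  rewrite lerBlDr addrC; apply: le_trans (rnormD _ _).
  by apply: q_le => i; rewrite !linearD /= x'P y'P.
have qZ a x : q (a *: x) <= rnorm (a : K^o) * q x.
  have q_leZ y : (forall i, f i y = f i x) -> q (a *: x) <= rnorm (a : K^o) * rnorm y.
    by move=> yx; rewrite -rnormZ; apply: q_le => i; rewrite !linearZ /= yx.
  have [a0|a0] := eqVneq (a : K^o) 0.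
    by have := q_leZ x (fun=> erefl); rewrite a0 rnorm0 !mul0r.
  rewrite mulrC -ler_pdivrMr ?rnorm_gt0//; apply: lb_le_inf => // _ [y yx <-].
  by rewrite ler_pdivrMr ?rnorm_gt0// mulrC; exact: q_leZ.
have q_norm x : q x <= rnorm x by exact: q_le.
have qz j : q (z j) <= c.
  have [g [gl gq gz]] := hahn_banach_seminorm (z j) qD qZ.
  pose G : {linear X -> K^o} := HB.pack g (GRing.isLinear.Build _ _ _ _ g gl).
  have gE x : g x = \sum_i g (z i) * f i x.
    have : G (x - \sum_i f i x *: z i) = 0.
      apply: rnorm_eq0; apply/eqP; rewrite eq_le rnorm_ge0 andbT.
      apply: le_trans (gq _) _; rewrite -(rnorm0 X); apply: q_le => i.
      rewrite linear0 linearB linear_sum /= (bigD1 i)//= linearZ /= zP eqxx.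
      rewrite big1 => [|l li]; last by rewrite linearZ /= zP eq_sym (negPf li) scaler0.
      by rewrite addr0 /GRing.scale /= mulr1 subrr.
    rewrite linearB linear_sum => /eqP; rewrite subr_eq0 => /eqP gx.
    by rewrite [LHS]gx; apply: eq_bigr => i _; rewrite linearZ mulrC.
  rewrite -gz; apply: (bc (fun i => g (z i))); rewrite -lee_fin dual_rnormE.
  apply: (@opnorm_le _ _ _ _ _ 1) => // x; rewrite mul1r dual_sum.
  under eq_bigr do rewrite dualZ.
  by rewrite -gE (le_trans (gq x)).
have /choice[x xP] j : exists x, (forall i, f i x = f i (z j)) /\ rnorm x <= c'.
  have [|_ [x xz <-] xc'] := @inf_lt _ (fiber (z j)) c' (fiber0 _).
    exact: le_lt_trans (qz j) cc'.
  by exists x; split=> //; exact: ltW.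
exists x => [i j|i]; last exact: (xP i).2.
by rewrite (xP j).1 zP.
Qed.

End Biorthogonal.

(** * Vectors that span an almost Euclidean plane *)

Section EuclideanPairs.
Context {R : realType} {k : scalar_kind} {X : normedModType (scalar_field R k)}.
Notation K := (scalar_field R k).

(** The images under [S] of an orthonormal basis, with [s] and [t] the norms of
    [S] and of its inverse. *)
Lemma eta2_pair (r : R) : (eta2 X < r%:E)%E ->
  exists (x : 'I_2 -> X) (s t : R), [/\ 0 < s /\ 0 < t, s * t < r,
    forall i, 1 <= t * rnorm (x i) &
    forall f : dual X, rnorm f <= 1 ->
      \sum_i rnorm (f (x i) : K^o) ^+ 2 <= s ^+ 2].
Proof.
move=> /eta2_lt[E [T [S [s [t [ST [s0 t0] str Tt Ss]]]]]].
exists (fun i => val (S (unit_vec i))), s, t; split=> // [i|f f1].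
  by rewrite -(@rnorm_unit_vec R k _ i) -{1}(ST (unit_vec i)); exact: Tt.
apply: (@ell2_functional_le _ _ _ (fun v => f (val (S v)))) => [a u v|v].
  by rewrite !linearP.
exact: le_trans (dual_ball_ub _ f1) (Ss v).
Qed.

(** The coefficients [b] of a combination of the [f i] of norm at most [1] have
    Euclidean norm at most the norm of the inverse [T] of [S], as
    [b = T (S b)]. Helly's theorem asks for a slightly larger bound, which is
    chosen so that the product with [s] remains below [r]. *)
Lemma eta2_dual_pair (r : R) : (eta2 (dual X) < r%:E)%E ->
  exists (f : 'I_2 -> dual X) (x : 'I_2 -> X) (s t : R),
    [/\ 0 < s /\ 0 < t, s * t < r, biorthogonal f x,
      forall i, rnorm (x i) <= t &
      forall y, \sum_i rnorm (f i y : K^o) ^+ 2 <= (s * rnorm y) ^+ 2].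
Proof.
move=> /eta2_lt[E [T [S [s [t [ST [s0 t0] str Tt Ss]]]]]].
pose f i : dual X := val (S (unit_vec i)).
have fE (b : 'I_2 -> K) : \sum_i b i *: f i = val (S (coord_vec b)).
  by rewrite coord_vecE !linear_sum; apply: eq_bigr => i _; rewrite !linearZ.
have bT (b : 'I_2 -> K) i : rnorm (b i : K^o) <= t * rnorm (\sum_i b i *: f i).
  apply: le_trans (rnorm_coord b i) _; rewrite fE -{1}(ST (coord_vec b)).
  exact: Tt.
have f_free : free_family f.
  move=> b b0 i; apply: (@rnorm_eq0 R k K^o); apply/eqP.
  by rewrite eq_le rnorm_ge0 andbT (le_trans (bT b i))// b0 rnorm0 mulr0.
have tr : t < r / s by rewrite ltr_pdivlMr// mulrC.
have [||x xP xt] := @helly_biorthogonal _ _ _ _ f t ((t + r / s) / 2) f_free.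
- by rewrite midf_lt.
- move=> b b1 i; apply: le_trans (bT b i) _.
  by rewrite ler_piMr// ltW.
exists f, x, s, ((t + r / s) / 2); split=> //.
- by rewrite s0 (lt_trans t0)// midf_lt.
- by rewrite mulrC -ltr_pdivlMr// midf_lt.
- move=> y; apply: (@ell2_functional_le _ _ _ (fun v => dual_fun (val (S v)) y)).
    by move=> a u v; rewrite !linearP.
  move=> v; apply: le_trans (dual_rnorm_ub _ _) _.
  by rewrite mulrAC ler_wpM2r ?rnorm_ge0//; exact: Ss.
Qed.

End EuclideanPairs.

(** * Tensor norms of signed diagonal tensors *)

Section DiagonalTensors.
Context {R : realType} {k : scalar_kind} {X Y : normedModType (scalar_field R k)}.
Notation K := (scalar_field R k).
Variable n : nat.
Implicit Types (x : 'I_n -> X) (y : 'I_n -> Y) (sg : 'I_n -> bool).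

Lemma rnorm_sign (b : bool) : rnorm ((-1) ^+ b : K^o) = 1.
Proof. by apply: rnorm_eq1; rewrite normr_sign. Qed.

Lemma signed_sum_mul_le (a b : 'I_n -> K) sg (c d : R) : 0 <= c -> 0 <= d ->
  \sum_i rnorm (a i : K^o) ^+ 2 <= c ^+ 2 ->
  \sum_i rnorm (b i : K^o) ^+ 2 <= d ^+ 2 ->
  rnorm (\sum_i (-1) ^+ sg i * (a i * b i) : K^o) <= c * d.
Proof.
move=> c0 d0 ac bd; apply: le_trans (rnorm_sum _ _) _.
under eq_bigr do rewrite !rnorm_mul rnorm_sign mul1r.
apply: le_trans (sum_mul_le_sqrt _ _) _.
by apply: ler_pM; rewrite ?sqrtr_ge0// -[leRHS]ger0_norm// -sqrtr_sqr ler_wsqrtr.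
Qed.

Lemma signed_diag_tensorE x y sg :
  \sum_i (-1) ^+ sg i *: (x i ⊗ y i) =
  \sum_(p <- [seq ((-1) ^+ sg i *: x i, y i) | i <- index_enum 'I_n]) p.1 ⊗ p.2.
Proof. by rewrite big_map; apply: eq_bigr => i _; rewrite tensorZl. Qed.

Lemma injective_norm_diag_le x y sg (c d : R) : 0 <= c -> 0 <= d ->
  (forall f : dual X, rnorm f <= 1 ->
     \sum_i rnorm (f (x i) : K^o) ^+ 2 <= c ^+ 2) ->
  (forall g : dual Y, rnorm g <= 1 ->
     \sum_i rnorm (g (y i) : K^o) ^+ 2 <= d ^+ 2) ->
  (injective_norm (\sum_i (-1) ^+ sg i *: (x i ⊗ y i))%R <= (c * d)%:E)%E.
Proof.
move=> c0 d0 xc yd; rewrite signed_diag_tensorE.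
apply: injective_norm_le => f g f1 g1; rewrite big_map /=.
under eq_bigr do rewrite linearZ /= -mulrA.
exact: signed_sum_mul_le (xc f f1) (yd g g1).
Qed.

(** The form [\sum_i ± f i ⊗ g i], with the signs of the tensor, takes the value
    [n] on it and is bounded by [c * d]. *)
Lemma le_projective_norm_diag (f : 'I_n -> dual X) (g : 'I_n -> dual Y) x y sg
    (c d : R) : 0 < c -> 0 < d -> biorthogonal f x -> biorthogonal g y ->
  (forall u, \sum_i rnorm (f i u : K^o) ^+ 2 <= (c * rnorm u) ^+ 2) ->
  (forall v, \sum_i rnorm (g i v : K^o) ^+ 2 <= (d * rnorm v) ^+ 2) ->
  ((n%:R / (c * d))%:E <=
     projective_norm (\sum_i (-1) ^+ sg i *: (x i ⊗ y i))%R)%E.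
Proof.
move=> c0 d0 fx gy fc gd; rewrite signed_diag_tensorE.
pose B u v : K^o := \sum_i (-1) ^+ sg i * (f i u * g i v).
have Bl v : linear (B^~ v).
  move=> a u u'; rewrite /B scaler_sumr -big_split; apply: eq_bigr => i _ /=.
  by rewrite linearP /= /GRing.scale /=; ring.
have Br u : linear (B u).
  move=> a v v'; rewrite /B scaler_sumr -big_split; apply: eq_bigr => i _ /=.
  by rewrite linearP /= /GRing.scale /=; ring.
have Bcd u v : rnorm (B u v) <= (c * d) * (rnorm u * rnorm v).
  by rewrite mulrACA signed_sum_mul_le// mulr_ge0 ?rnorm_ge0// ltW.
have := le_projective_norm
  [seq ((-1) ^+ sg i *: x i, y i) | i <- index_enum 'I_n] Bl Br
  (mulr_gt0 c0 d0) Bcd.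
apply: le_trans; rewrite lee_fin ler_wpM2r//; first by rewrite invr_ge0 mulr_ge0 ?ltW.
rewrite big_map /=.
suff -> : \sum_i B ((-1) ^+ sg i *: x i) (y i) = of_real k n%:R.
  by rewrite rnorm_of_real.
rewrite (_ : of_real k n%:R = n%:R); last first.
  by elim: (n) => [|m IHm]; rewrite ?of_real0// -addn1 !natrD of_realD IHm of_real1.
rewrite -[n in RHS]card_ord -sumr_const; apply: eq_bigr => j _.
rewrite /B (bigD1 j)//= linearZ /= fx gy eqxx mulr1 big1 ?addr0 => [|i ij].
  by rewrite /GRing.scale /= mulr1 -expr2 sqrr_sign.
by rewrite gy (negPf ij) !mulr0.
Qed.

End DiagonalTensors.

(** * Lower bounds for the von Neumann-Jordan constant *)

Section NeumannJordan.
Context {R : realType} {k : scalar_kind}.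
Notation K := (scalar_field R k).

Lemma rnorm2 : rnorm (2 : K^o) = 2.
Proof. by rewrite (_ : 2 = of_real k 2) ?rnorm_of_real// of_realD of_real1. Qed.

Lemma add_addB (Z : lmodType K) (a b : Z) : a + b + (a - b) = 2 *: a.
Proof. by rewrite addrACA subrr addr0 -mulr2n scaler_nat. Qed.

Lemma sub_addB (Z : lmodType K) (a b : Z) : a + b - (a - b) = 2 *: b.
Proof. by rewrite opprB addrCA addrAC subrr add0r -mulr2n scaler_nat. Qed.

Lemma CNJ_ub (Z : normedModType K) (a b : Z) : (a, b) != (0, 0) ->
  (((rnorm (a + b) ^+ 2 + rnorm (a - b) ^+ 2) /
    (2 * (rnorm a ^+ 2 + rnorm b ^+ 2)))%:E <= CNJ Z)%E.
Proof.
by move=> ab0; apply: ereal_sup_ubound; exists (a, b).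
Qed.

Lemma CNJ_ge0 (X : normedModType K) (x : X) : rnorm x = 1 -> (0 <= CNJ X)%E.
Proof.
move=> x1; have x0 : (x, 0) != (0, 0) :> X * X.
  by apply/eqP => -[x0]; move: x1; rewrite x0 rnorm0; lra.
apply: le_trans (CNJ_ub x0); rewrite lee_fin divr_ge0 ?mulr_ge0 ?addr_ge0//;
  exact: sqr_ge0.
Qed.

Lemma CNJ_isometry (X Z : normedModType K) (h : {linear X -> Z}) :
  (forall x, rnorm (h x) = rnorm x) -> (CNJ X <= CNJ Z)%E.
Proof.
move=> hn; apply: ge_ereal_sup => _ [[x y] /= xy0 <-].
apply: ereal_sup_ubound; exists (h x, h y); last first.
  by rewrite /= -linearD -linearB !hn.
apply: contra xy0; rewrite !xpair_eqE => /andP[/eqP hx /eqP hy].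
by apply/andP; split; apply/eqP; apply: rnorm_eq0; rewrite -hn ?hx ?hy rnorm0.
Qed.

(** The pair is [(a + b, a - b)], whose sum and difference are [2 a] and
    [2 b]. *)
Lemma CNJ_ge_diag (Z : normedModType K) (a b : Z) (m M : R) : 0 < m -> 0 < M ->
  m <= rnorm a -> m <= rnorm b -> rnorm (a + b) <= M -> rnorm (a - b) <= M ->
  ((2 * (m / M) ^+ 2)%:E <= CNJ Z)%E.
Proof.
move=> m0 M0 ma mb abM abM'.
have a0 : a != 0 by apply: contraTneq ma => ->; rewrite rnorm0 -ltNge.
have ab0 : (a + b, a - b) != (0, 0).
  apply: contra a0; rewrite xpair_eqE => /andP[/eqP ab0 /eqP ab0'].
  have := add_addB a b; rewrite ab0 ab0' addr0 => /esym/eqP.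
  by rewrite scaler_eq0 pnatr_eq0.
apply: le_trans (CNJ_ub ab0); rewrite add_addB sub_addB !rnormZ rnorm2 lee_fin.
set p := rnorm a in ma *; set q := rnorm b in mb *.
set u := rnorm (a + b) in abM *; set v := rnorm (a - b) in abM' *.
have sqle (w z : R) : 0 <= w -> w <= z -> w ^+ 2 <= z ^+ 2.
  by move=> w0 wz; rewrite ler_sqr// nnegrE (le_trans w0).
have mp := sqle _ _ (ltW m0) ma; have mq := sqle _ _ (ltW m0) mb.
have uM := sqle _ _ (rnorm_ge0 (a + b)) abM.
have vM := sqle _ _ (rnorm_ge0 (a - b)) abM'.
have uv0 : 0 < u ^+ 2 + v ^+ 2.
  rewrite lt_neqAle eq_sym addr_ge0 ?sqr_ge0// andbT.
  rewrite paddr_eq0 ?sqr_ge0// !sqrf_eq0; apply: contra ab0.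
  by rewrite xpair_eqE => /andP[/eqP/rnorm_eq0 -> /eqP/rnorm_eq0 ->]; rewrite eqxx.
rewrite expr_div_n mulrA ler_pdivrMr ?exprn_gt0// mulrAC ler_pdivlMr ?mulr_gt0//.
rewrite !exprMn; move: mp mq uM vM uv0; rewrite -/u -/v.
have : 0 < m ^+ 2 by rewrite exprn_gt0.
have : 0 < M ^+ 2 by rewrite exprn_gt0.
move: (m ^+ 2) (M ^+ 2) (p ^+ 2) (q ^+ 2) (u ^+ 2) (v ^+ 2) => m2 M2 p2 q2 u2 v2.
nra.
Qed.

End NeumannJordan.

Lemma two_div_sqr_le (R : realType) (r r' p q : R) : 0 < p -> p < r ->
  0 < q -> q < r' -> 2 / (r * r') ^+ 2 <= 2 * (p * q)^-1 ^+ 2.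
Proof.
move=> p0 pr q0 qr'; rewrite -exprVn ler_pM2l// ler_sqr ?nnegrE ?invr_ge0; last 2 first.
- by rewrite mulr_ge0// ltW// (lt_trans _ pr, lt_trans _ qr').
- by rewrite mulr_ge0// ltW.
rewrite lef_pV2 ?posrE ?mulr_gt0// ?(lt_trans p0 pr) ?(lt_trans q0 qr')//.
by rewrite ler_pM// ltW.
Qed.

(** Passage to the infima [a] and [b]. The left-hand side is [0] when one of them
    is infinite, thanks to the lower bounds by [1]; otherwise take
    [r = a (1 + e)] and [s = b (1 + e)] with [e] tending to [0]. *)
Lemma le_two_div_sqr (R : realType) (a b C : \bar R) :
  (1 <= a)%E -> (1 <= b)%E -> (0 <= C)%E ->
  (forall r s : R, (a < r%:E)%E -> (b < s%:E)%E ->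
     ((2 / (r * s) ^+ 2)%:E <= C)%E) ->
  (2%:E / (a ^+ 2 * b ^+ 2) <= C)%E.
Proof.
have sqy (c : \bar R) : (1 <= c)%E -> (0 < c ^+ 2)%E.
  by move=> c1; rewrite expe_gt0// (lt_le_trans _ c1)// lte01.
move=> a1 b1; have a2 := sqy _ a1; have b2 := sqy _ b1.
case: a a1 a2 => [a| |]//; last first.
  by move=> _ _ C0 _; rewrite (expe2 +oo) mulyy gt0_mulye// invey mule0.
move=> a1 a2; case: b b1 b2 => [b| |]//; last first.
  move=> _ _ C0 _.
  by rewrite (expe2 +oo) mulyy gt0_muley// invey mule0.
move=> b1 _ {a2}; rewrite !lee_fin in a1 b1.
have a0 : 0 < a by lra.
have b0 : 0 < b by lra.
rewrite -!EFin_expe -EFinM -exprMn inver gt_eqF ?exprn_gt0 ?mulr_gt0// -EFinM.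
case: C => [c| |]; [|by move=> _ _; rewrite leey|by []].
rewrite !lee_fin => c0 cP.
set D := 2 / (a * b) ^+ 2.
have D0 : 0 < D by rewrite divr_gt0 ?exprn_gt0 ?mulr_gt0.
have DP e : 0 < e -> D <= c * (1 + e) ^+ 4.
  move=> e0; have e1 : 0 < 1 + e by lra.
  rewrite -ler_pdivrMr ?exprn_gt0// -lee_fin.
  have -> : D / (1 + e) ^+ 4 = 2 / (a * (1 + e) * (b * (1 + e))) ^+ 2.
    by rewrite /D; field; rewrite !gt_eqF.
  by apply: cP; rewrite ?lte_fin; nra.
clearbody D; rewrite leNgt; apply/negP => cD.
have D16 : 0 < 16 * D by rewrite mulr_gt0.
(* Small enough for [c (1 + e)^4 <= c (1 + 15 e) < D]. *)
pose e := (D - c) / (16 * D).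
have eD : 16 * D * e = D - c by rewrite /e mulrC divfK// gt_eqF.
have e0 : 0 < e by rewrite divr_gt0 ?subr_gt0.
have e1 : e <= 1 by rewrite ler_pdivrMr// mul1r; lra.
clearbody e; have := DP e e0; apply/negP; rewrite -ltNge.
have e4 : (1 + e) ^+ 4 <= 1 + 15 * e.
  have -> : (1 + e) ^+ 4 = 1 + e * (4 + e * (6 + e * (4 + e))) by ring.
  rewrite lerD2l [15 * e]mulrC ler_wpM2l ?ltW//; nra.
apply: le_lt_trans (ler_wpM2l c0 e4) _; nra.
Qed.

(** * Completions of the tensor product *)

Lemma dim_ge_unit (R : realType) (k : scalar_kind)
    (X : normedModType (scalar_field R k)) n :
  dim_ge X n.+1 -> exists x : X, rnorm x = 1.
Proof.
move=> [b b_free]; have b0 : b ord0 != 0.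
  apply/eqP => b0; have := b_free (fun i => (i == ord0)%:R).
  rewrite (bigD1 ord0)//= b0 scaler0 add0r big1 => [|i /negPf ->]; last first.
    by rewrite scale0r.
  by move=> /(_ erefl ord0); rewrite eqxx => /eqP; rewrite oner_eq0.
exists (of_real k (rnorm (b ord0))^-1 *: b ord0).
by rewrite rnormZ rnorm_of_real ?invr_ge0 ?rnorm_ge0// mulVf// gt_eqF// rnorm_gt0.
Qed.

Section Completion.
Context {R : realType} {k : scalar_kind} {X Y : normedModType (scalar_field R k)}.
Notation K := (scalar_field R k).
Variables (Z : normedModType K) (j : {linear tensor X Y -> Z}).

(** Tensoring with a unit vector of the other factor is an isometric
    embedding. *)
Lemma CNJ_factor (alpha : tensor X Y -> \bar R) :
  dim_ge X 2 -> dim_ge Y 2 -> (forall w, (rnorm (j w))%:E = alpha w) ->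
  (forall x y, alpha (x ⊗ y) = (rnorm x * rnorm y)%:E) ->
  (CNJ X <= CNJ Z)%E /\ (CNJ Y <= CNJ Z)%E.
Proof.
move=> hX hY ja alphaE.
have jE x y : rnorm (j (x ⊗ y)) = rnorm x * rnorm y.
  by apply: EFin_inj; rewrite ja alphaE.
have [x0 x01] := dim_ge_unit hX; have [y0 y01] := dim_ge_unit hY.
have hl : linear (fun x => j (x ⊗ y0)).
  by move=> a x x'; rewrite tensorDl tensorZl linearP.
have hr : linear (fun y => j (x0 ⊗ y)).
  by move=> a y y'; rewrite tensorDr tensorZr linearP.
pose HL : {linear X -> Z} := HB.pack (fun x => j (x ⊗ y0))
  (GRing.isLinear.Build _ _ _ _ _ hl).
pose HR : {linear Y -> Z} := HB.pack (fun y => j (x0 ⊗ y))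
  (GRing.isLinear.Build _ _ _ _ _ hr).
split; [apply: (@CNJ_isometry _ _ _ _ HL)|apply: (@CNJ_isometry _ _ _ _ HR)].
  by move=> x /=; rewrite jE y01 mulr1.
by move=> y /=; rewrite jE x01 mul1r.
Qed.

Lemma diag2E (x : 'I_2 -> X) (y : 'I_2 -> Y) (w := fun i => x i ⊗ y i) :
  (\sum_i (-1) ^+ false *: w i = w ord0 + w ord_max) /\
  (\sum_i (-1) ^+ (i != ord0) *: w i = w ord0 - w ord_max).
Proof.
have max1 : lift ord0 ord0 = ord_max :> 'I_2 by apply: val_inj.
by split; rewrite big_ord_recl big_ord1 max1 /= expr0 scale1r (scale1r, scaleN1r).
Qed.

(** The tensors [w i] play the role of the [e_i ⊗ e_i] of the operator norm on a
    Euclidean plane. *)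
Lemma CNJ_injective_eta2 :
  (forall w, (rnorm (j w))%:E = injective_norm w) -> (0 <= CNJ Z)%E ->
  (2%:E / (eta2 X ^+ 2 * eta2 Y ^+ 2) <= CNJ Z)%E.
Proof.
move=> jn Z0; apply: le_two_div_sqr => //; [exact: eta2_ge1|exact: eta2_ge1|].
move=> r r' /eta2_pair[x [s [t [[s0 t0] str xt xs]]]].
move=> /eta2_pair[y [s' [t' [[s'0 t'0] str' yt ys]]]].
pose w i := x i ⊗ y i.
have w_ge i : 1 / (t * t') <= rnorm (j (w i)).
  have -> : rnorm (j (w i)) = rnorm (x i) * rnorm (y i).
    by apply: EFin_inj; rewrite jn injective_norm_elementary.
  by rewrite ler_pdivrMr ?mulr_gt0// mulrC mulrACA -[leLHS]mulr1 ler_pM.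
have w_le (sg : 'I_2 -> bool) : rnorm (j (\sum_i (-1) ^+ sg i *: w i)) <= s * s'.
  by rewrite -lee_fin jn; apply: injective_norm_diag_le => //; exact: ltW.
have [wD wB] := diag2E x y.
have wDs := w_le (fun=> false); have wBs := w_le (fun i => i != ord0).
rewrite wD linearD in wDs; rewrite wB linearB in wBs.
have t2 : 0 < 1 / (t * t') by rewrite divr_gt0 ?mulr_gt0.
apply: le_trans (CNJ_ge_diag t2 (mulr_gt0 s0 s'0) (w_ge _) (w_ge _) wDs wBs).
have -> : 1 / (t * t') / (s * s') = (s * t * (s' * t'))^-1.
  by field; rewrite !gt_eqF.
by rewrite lee_fin; apply: two_div_sqr_le => //; exact: mulr_gt0.
Qed.

(** The tensors [w i] play the role of the [e_i ⊗ e_i] of the trace class norm on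
    a Euclidean plane. *)
Lemma CNJ_projective_eta2 :
  (forall w, (rnorm (j w))%:E = projective_norm w) -> (0 <= CNJ Z)%E ->
  (2%:E / (eta2 (dual X) ^+ 2 * eta2 (dual Y) ^+ 2) <= CNJ Z)%E.
Proof.
move=> jn Z0; apply: le_two_div_sqr => //; [exact: eta2_ge1|exact: eta2_ge1|].
move=> r r' /eta2_dual_pair[f [x [s [t [[s0 t0] str fx xt fs]]]]].
move=> /eta2_dual_pair[g [y [s' [t' [[s'0 t'0] str' gy yt gs]]]]].
pose w i := x i ⊗ y i.
have w_le i : rnorm (j (w i)) <= t * t'.
  have -> : rnorm (j (w i)) = rnorm (x i) * rnorm (y i).
    by apply: EFin_inj; rewrite jn projective_norm_elementary.
  by rewrite ler_pM ?rnorm_ge0.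
have w_ge (sg : 'I_2 -> bool) : 2 / (s * s') <= rnorm (j (\sum_i (-1) ^+ sg i *: w i)).
  by rewrite -lee_fin jn; apply: (le_projective_norm_diag _ _ _ fx gy).
have [wD wB] := diag2E x y.
have wDs := w_ge (fun=> false); have wBs := w_ge (fun i => i != ord0).
rewrite wD linearD in wDs; rewrite wB linearB in wBs.
set a := j (w ord0) in wDs wBs *; set b := j (w ord_max) in wDs wBs *.
have m0 : 0 < 2 / (s * s') by rewrite divr_gt0 ?mulr_gt0.
have M0 : 0 < 2 * (t * t') by rewrite mulr_gt0 ?mulr_gt0.
(* The quotient of [(2 a, 2 b)], which is that of [(a, b)]. *)
have sum_le : rnorm (a + b + (a - b)) <= 2 * (t * t').
  by rewrite add_addB rnormZ rnorm2 ler_pM2l//; exact: w_le.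
have sub_le : rnorm (a + b - (a - b)) <= 2 * (t * t').
  by rewrite sub_addB rnormZ rnorm2 ler_pM2l//; exact: w_le.
apply: le_trans (CNJ_ge_diag m0 M0 wDs wBs sum_le sub_le).
have -> : 2 / (s * s') / (2 * (t * t')) = (s * t * (s' * t'))^-1.
  by field; rewrite !gt_eqF.
by rewrite lee_fin; apply: two_div_sqr_le => //; exact: mulr_gt0.
Qed.

End Completion.

Local Open Scope ereal_scope.

Theorem theorem3p3 (R : realType) (k : scalar_kind)
    (X Y : completeNormedModType (scalar_field R k))
    (hX : dim_ge X 2) (hY : dim_ge Y 2) :
  (forall (Z : completeNormedModType (scalar_field R k))
      (j : {linear tensor X Y -> Z}),
    is_completion (@injective_norm R k X Y) j ->
    maxe (CNJ X) (maxe (CNJ Y) (2%:E / (eta2 X ^+ 2 * eta2 Y ^+ 2))) <= CNJ Z)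
  /\
  (forall (Z : completeNormedModType (scalar_field R k))
      (j : {linear tensor X Y -> Z}),
    is_completion (@projective_norm R k X Y) j ->
    maxe (CNJ X) (maxe (CNJ Y)
      (2%:E / (eta2 (dual X) ^+ 2 * eta2 (dual Y) ^+ 2))) <= CNJ Z).
Proof.
have [x0 x01] := dim_ge_unit hX.
split=> Z j [jn _].
- have [XZ YZ] := CNJ_factor hX hY jn injective_norm_elementary.
  rewrite !ge_max XZ YZ /=; apply: CNJ_injective_eta2 jn _.
  exact: le_trans (CNJ_ge0 x01) XZ.
- have [XZ YZ] := CNJ_factor hX hY jn projective_norm_elementary.
  rewrite !ge_max XZ YZ /=; apply: CNJ_projective_eta2 jn _.
  exact: le_trans (CNJ_ge0 x01) XZ.
Qed.
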